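(* Let $\mathcal{H}^S$ and $\mathcal{H}^E$ be Hilbert spaces, let $H$ be a Hamiltonian (self-adjoint operator) on $\mathcal{H}^{S}\otimes\mathcal{H}^{E}$, and let $U(t)=\exp(-iHt/\hbar)$. Let $\rho_1^{SE}(0),\rho_2^{SE}(0)$ be arbitrary (possibly correlated) density operators on $\mathcal{H}^S\otimes\mathcal{H}^E$, evolving as $\rho_i^{SE}(t)=U(t)\rho_i^{SE}(0)U^\dagger(t)$, $i=1,2$. Then for every $t\ge0$ the sum of the net changes in subsystem distinguishability satisfies $$-\delta_0-\tfrac12\|\Xi^{SE}(t)\|_1-\tfrac12\|\Xi^{SE}(0)\|_1\;\le\;\Delta D_S+\Delta D_E\;\le\;D_S^0+D_E^0+\|\Xi^{SE}(0)\|_1,$$ where $\Delta D_S=D_S^t-D_S^0$, $\Delta D_E=D_E^t-D_E^0$, $\delta_0=D_S^0+D_E^0-D_{\mathrm{prod}}^0$ with $D_{\mathrm{prod}}^0=D\big(\rho_1^S(0)\otimes\rho_1^E(0),\,\rho_2^S(0)\otimes\rho_2^E(0)\big)$, and $\Xi^{SE}(t)$ is the correlation difference operator at time $t$.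
   Context: For density operators $\rho_1,\rho_2$ the trace distance is $D(\rho_1,\rho_2)=\frac12\|\rho_1-\rho_2\|_1$, where $\|A\|_1=\operatorname{Tr}\sqrt{A^\dagger A}$ is the trace norm. The reduced states are $\rho_i^S(t)=\operatorname{Tr}_E[\rho_i^{SE}(t)]$ and $\rho_i^E(t)=\operatorname{Tr}_S[\rho_i^{SE}(t)]$ (partial traces), for $t\ge 0$. Set $D_S^t=D(\rho_1^S(t),\rho_2^S(t))$ and $D_E^t=D(\rho_1^E(t),\rho_2^E(t))$; $D_S^0$ and $D_E^0$ are the values at $t=0$. The correlation operators are $\chi_i^{SE}(t)=\rho_i^{SE}(t)-\rho_i^S(t)\otimes\rho_i^E(t)$, $i=1,2$, and the correlation difference operator is $\Xi^{SE}(t)=\chi_1^{SE}(t)-\chi_2^{SE}(t)$, for all $t\ge0$ (including $t=0$). *)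

(* Defs.v *)
From HB Require Import structures.
From mathcomp Require Import all_boot all_order all_algebra.
From mathcomp Require Import sesquilinear.
From mathcomp Require Import complex.
From mathcomp Require Import all_classical all_reals all_analysis.

Set Implicit Arguments.
Unset Strict Implicit.
Unset Printing Implicit Defensive.

Import Order.TTheory GRing.Theory Num.Theory.
Import numFieldNormedType.Exports.

Local Open Scope classical_set_scope.
Local Open Scope complex_scope.
Local Open Scope ring_scope.

(* Complex Hilbert spaces of arbitrary dimension. Following the library's dot
   forms, the inner product is linear in its first argument and antilinear in
   its second one. *)
HB.mixin Record isHilbert (R : realType) H of CompleteNormedModule R[i] H := {
  hdot : {dot H for (@Num.conj R[i])} ;
  hdot_norm : forall x : H, hdot x x = `|x| ^+ 2
}.

#[short(type="hilbertType")]
HB.structure Definition Hilbert (R : realType) :=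
  {H of CompleteNormedModule R[i] H & isHilbert R H}.

Section Operators.
Context {R : realType}.

Definition bounded_op (V W : hilbertType R) (A : V -> W) : Prop :=
  linear A /\ continuous A.

Definition pos_op (V : hilbertType R) (A : V -> V) : Prop :=
  bounded_op A /\ forall x, 0 <= hdot (A x) x.

(* Adjoints, square roots, partial traces and tensor products of operators are
   definite descriptions: each set below has at most one element, and the
   default value 0 is returned only if it is empty. *)
Definition adjoint (V : hilbertType R) (A : V -> V) : V -> V :=
  xget (fun=> 0)
    [set B | bounded_op B /\ forall x y, hdot (A x) y = hdot x (B y)].

Definition sqrt_op (V : hilbertType R) (A : V -> V) : V -> V :=
  xget (fun=> 0) [set B | pos_op B /\ B \o B = A].

Definition orthonormal_basis (V : hilbertType R) (B : set V) : Prop :=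
  (forall u v, B u -> B v -> hdot u v = (u == v)%:R) /\
  (forall x, (forall u, B u -> hdot x u = 0) -> x = 0).

Definition hbasis (V : hilbertType R) : set V :=
  xget set0 [set B | orthonormal_basis B].
Arguments hbasis V : clear implicits.

(* Trace of a positive operator, possibly +oo; it does not depend on the
   orthonormal basis. *)
Definition trace (V : hilbertType R) (A : V -> V) : \bar R :=
  \esum_(e in hbasis V) (complex.Re (hdot (A e) e))%:E.

Definition trnorm (V : hilbertType R) (A : V -> V) : \bar R :=
  trace (sqrt_op (adjoint A \o A)).

Definition trdist (V : hilbertType R) (A B : V -> V) : \bar R :=
  ((2^-1)%:E * trnorm (A \- B)%R)%E.

Definition density_op (V : hilbertType R) (A : V -> V) : Prop :=
  pos_op A /\ trace A = 1%E.

(* Unconditional convergence of the sum of the f i, i in B, to s. *)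
Definition has_sum (I : choiceType) (B : set I) (f : I -> R[i]) (s : R[i]) :=
  forall eps : R, 0 < eps -> exists2 F0, fsets B F0 &
    forall F, fsets B F -> F0 `<=` F ->
      `|s - \sum_(i \in F) f i| < eps%:C.

End Operators.

Arguments hbasis {R} V.

Section TensorProduct.
Context {R : realType} {HS HE HSE : hilbertType R}.
Variable tens : {bilinear HS -> HE -> HSE}.

(* HSE, with the elementary tensors tens x y, is a completion of the algebraic
   tensor product of HS and HE for the product inner product. *)
Definition hilbert_tensor : Prop :=
  (forall x x' y y',
     hdot (tens x y) (tens x' y') = hdot x x' * hdot y y') /\
  dense [set z | exists n (x : 'I_n -> HS) (y : 'I_n -> HE),
           z = \sum_(i < n) tens (x i) (y i)].

Definition tensor_op (A : HS -> HS) (B : HE -> HE) : HSE -> HSE :=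
  xget (fun=> 0)
    [set T | bounded_op T /\ forall x y, T (tens x y) = tens (A x) (B y)].

Definition ptraceE (T : HSE -> HSE) : HS -> HS :=
  xget (fun=> 0) [set A | bounded_op A /\ forall x x',
    has_sum (hbasis HE) (fun e => hdot (T (tens x e)) (tens x' e))
      (hdot (A x) x')].

Definition ptraceS (T : HSE -> HSE) : HE -> HE :=
  xget (fun=> 0) [set A | bounded_op A /\ forall y y',
    has_sum (hbasis HS) (fun e => hdot (T (tens e y)) (tens e y'))
      (hdot (A y) y')].

Definition correlation (rho : HSE -> HSE) : HSE -> HSE :=
  rho \- tensor_op (ptraceE rho) (ptraceS rho).

End TensorProduct.

Section SelfAdjoint.
Context {R : realType} {V : hilbertType R}.

(* Possibly unbounded operators A with domain D; the values of A outside D are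
   irrelevant. The last clause states that the graphs of A and of its adjoint
   coincide. *)
Definition selfadjoint_op (D : set V) (A : V -> V) : Prop :=
  [/\ dense D,
      D 0,
      forall (a : R[i]) x y, D x -> D y ->
        D (a *: x + y) /\ A (a *: x + y) = a *: A x + A y &
      forall y z, (D y /\ A y = z) <->
        (forall x, D x -> hdot (A x) y = hdot x z)].

Definition projection_valued_measure (E : set R -> V -> V) : Prop :=
  [/\ forall B, measurable B -> [/\ bounded_op (E B), E B \o E B = E B &
        forall x y, hdot (E B x) y = hdot x (E B y)],
      E setT = id &
      forall F : (set R)^nat, (forall n, measurable (F n)) ->
        trivIset setT F -> forall x,
        (fun n => \sum_(0 <= k < n) E (F k) x) @ \oo --> E (\bigcup_n F n) x].

Definition spectral_mu (E : set R -> V -> V) (x : V) (B : set R) : \bar R :=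
  (complex.Re (hdot (E B x) x))%:E.

(* E is the projection-valued measure of (D, A): A is the integral of the
   identity against E, on its natural domain. Here and in functional_calculus,
   operators are given by their quadratic forms, which determine them because
   the scalars are complex. *)
Definition spectral_resolution (D : set V) (A : V -> V)
    (E : set R -> V -> V) : Prop :=
  [/\ projection_valued_measure E,
      D = [set x | (\int[spectral_mu E x]_(l in setT) (l ^+ 2)%:E < +oo)%E] &
      forall x, D x ->
        hdot (A x) x = (fine (\int[spectral_mu E x]_(l in setT) l%:E)%E)%:C].

(* T = f(A), for A self-adjoint with domain D and f bounded and Borel. *)
Definition functional_calculus (D : set V) (A : V -> V) (f : R -> R[i])
    (T : V -> V) : Prop :=
  bounded_op T /\ exists2 E, spectral_resolution D A E &
    forall x, hdot (T x) x =
      fine (\int[spectral_mu E x]_(l in setT) (complex.Re (f l))%:E)%E +i*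
      fine (\int[spectral_mu E x]_(l in setT) (complex.Im (f l))%:E)%E.

Definition expi (x : R) : R[i] := cos x +i* sin x.

(* U t = exp (- i A t / hbar) for all t. *)
Definition is_propagator (hbar : R) (D : set V) (A : V -> V)
    (U : R -> V -> V) : Prop :=
  forall t, functional_calculus D A (fun l => expi (- (l * t / hbar))) (U t).

Definition evolve (U : R -> V -> V) (rho : V -> V) (t : R) : V -> V :=
  U t \o rho \o adjoint (U t).

End SelfAdjoint.

(* Main.v *)
Require Import Defs.
From HB Require Import structures.
From mathcomp Require Import all_boot all_order all_algebra.
From mathcomp Require Import sesquilinear.
From mathcomp Require Import complex.
From mathcomp Require Import all_classical all_reals all_analysis.
From mathcomp Require Import zify ring lra.

Set Implicit Arguments.
Unset Strict Implicit.
Unset Printing Implicit Defensive.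

Import Order.TTheory GRing.Theory Num.Theory.
Import numFieldNormedType.Exports.

Local Open Scope classical_set_scope.
Local Open Scope ring_scope.

(* All operators that occur are differences of positive ones, and for a bounded
   self-adjoint [A] the trace norm is the least value of [tr X + tr Y] over the
   decompositions [A = X - Y] with [X], [Y] positive. Partial traces, conjugation
   by an isometry and tensoring with a state map positive operators to positive
   operators without increasing the trace, so the trace norm contracts under the
   first two, is subadditive, and satisfies
   [||a1 (x) b1 - a2 (x) b2|| <= ||a1 - a2|| + ||b1 - b2||] for states, because
   [a1 (x) b1 - a2 (x) b2 = (a1 - a2) (x) b1 + a2 (x) (b1 - b2)]. With [N] the
   trace norm of [rho1SE - rho2SE], which does not depend on the time, and [S],
   [E], [P], [X] those of the differences of the marginals, of the products of
   marginals and of the correlations, this gives at every time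
   [S <= N], [E <= N], [P <= S + E], [N <= P + X] and [P <= N + X]; the bounds
   are linear combinations of these at times [0] and [t].

   Minimality of [tr |A|] comes from [|A| = S A], with [S] the self-adjoint
   isometry [2 Pi - 1] for [Pi] the projection on the kernel of the negative part:
   if [A = X - Y] then [tr |A| = tr (S X) - tr (S Y)]. Everything is computed with
   the real inner product [Re <x, y>], which determines the complex one. *)

(** * The real inner product *)

(** Adjoints, square roots, partial traces and tensor products enter the statement as definite
    descriptions, so each needs existence and uniqueness before anything can be computed. Operators
    are obtained from bounded real forms invariant under ['i] in both arguments, represented by a
    minimization argument. Tensoring with the identity and partial traces arise as sums of forms
    [<u b x, u b y>]: positivity is then automatic and only a bound has to be found. The trace is
    meaningful for positive operators only and may be [+oo], so there is no linear functional to
    manipulate. Its invariance properties come from writing it as a Hilbert-Schmidt sum of squares,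
    where summations can be exchanged freely. The propagator is given through quadratic forms alone;
    that it preserves norms has to be recovered from the spectral measure. *)

Section RealInnerProduct.
Context {R : realType}.
Implicit Type V : hilbertType R.
Local Open Scope complex_scope.

Definition rdot V (x y : V) : R := complex.Re (hdot x y).
Definition n2 V (x : V) : R := rdot x x.

Lemma hdotC V (x y : V) : hdot x y = (hdot y x)^*%C.
Proof. by rewrite hermC expr0 mul1r. Qed.

Lemma rdotC V (x y : V) : rdot x y = rdot y x.
Proof. by rewrite /rdot hdotC; case: (hdot y x). Qed.

Lemma rdotDl V (x y z : V) : rdot (x + y) z = rdot x z + rdot y z.
Proof. by rewrite /rdot linearDl raddfD. Qed.

Lemma rdotDr V (x y z : V) : rdot z (x + y) = rdot z x + rdot z y.
Proof. by rewrite rdotC rdotDl !(rdotC z). Qed.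

Lemma rdotNl V (x z : V) : rdot (- x) z = - rdot x z.
Proof. by rewrite /rdot linearNl raddfN. Qed.

Lemma rdotNr V (x z : V) : rdot z (- x) = - rdot z x.
Proof. by rewrite rdotC rdotNl rdotC. Qed.

Lemma rdot0l V (z : V) : rdot 0 z = 0.
Proof. by rewrite /rdot linear0l raddf0. Qed.

Lemma rdot0r V (z : V) : rdot z 0 = 0.
Proof. by rewrite rdotC rdot0l. Qed.

Lemma rdotZl V (r : R) (x z : V) : rdot (r%:C *: x) z = r * rdot x z.
Proof. by rewrite /rdot linearZl_LR /=; case: (hdot x z) => a b /=; ring. Qed.

Lemma rdotZr V (r : R) (x z : V) : rdot z (r%:C *: x) = r * rdot z x.
Proof. by rewrite rdotC rdotZl rdotC. Qed.

Lemma hdotZr V (c : R[i]) (x y : V) : hdot x (c *: y) = c^*%C * hdot x y.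
Proof. by rewrite linearZr_LR. Qed.

Lemma hdotZl V (c : R[i]) (x y : V) : hdot (c *: x) y = c * hdot x y.
Proof. by rewrite linearZl_LR. Qed.

Lemma hdotBl V (x y z : V) : hdot (x - y) z = hdot x z - hdot y z.
Proof. by rewrite linearBl. Qed.

Lemma hdot_suml V (I : Type) (r : seq I) (F : I -> V) z :
  hdot (\sum_(i <- r) F i) z = \sum_(i <- r) hdot (F i) z.
Proof. by apply: (big_morph (hdot^~ z)) => [x y|]; rewrite ?linearDl ?linear0l. Qed.

Lemma hdot_sumr V (I : Type) (r : seq I) (F : I -> V) z :
  hdot z (\sum_(i <- r) F i) = \sum_(i <- r) hdot z (F i).
Proof. by apply: (big_morph (hdot z)) => [x y|]; rewrite ?linearDr ?linear0r. Qed.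

Lemma Im_hdot V (x y : V) : complex.Im (hdot x y) = rdot x ('i *: y).
Proof. by rewrite /rdot hdotZr; case: (hdot x y) => a b /=; ring. Qed.

Lemma hdotE V (x y : V) : hdot x y = rdot x y +i* rdot x ('i *: y).
Proof. by rewrite -Im_hdot /rdot; case: (hdot x y). Qed.

Lemma rdot_ii V (x y : V) : rdot ('i *: x) ('i *: y) = rdot x y.
Proof.
rewrite /rdot hdotZr linearZl_LR /=; case: (hdot x y) => a b /=; ring.
Qed.

Lemma scaleii V (x : V) : 'i *: ('i *: x) = - x :> V.
Proof.
rewrite scalerA (_ : 'i * 'i = -1) ?scaleN1r //.
by apply/eqP; rewrite eq_complex /=; apply/andP; split; apply/eqP; ring.
Qed.

Lemma rdot_il V (x y : V) : rdot ('i *: x) y = - rdot x ('i *: y).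
Proof. by rewrite -rdot_ii scaleii rdotNl. Qed.

Lemma rdotZcl V (c : R[i]) (x z : V) :
  rdot (c *: x) z = complex.Re c * rdot x z - complex.Im c * rdot x ('i *: z).
Proof.
by rewrite -Im_hdot /rdot linearZl_LR /=; case: (hdot x z) c => a b [c d] /=; ring.
Qed.

Lemma n2_ge0 V (x : V) : 0 <= n2 x.
Proof.
have : 0 <= hdot x x by exact: dnorm_ge0.
by rewrite lecE => /andP[].
Qed.

Lemma hdotxx V (x : V) : hdot x x = (n2 x)%:C.
Proof.
have /ger0_Im : 0 <= hdot x x by exact: dnorm_ge0.
by rewrite /n2 /rdot; case: (hdot x x) => a b /= ->.
Qed.

Lemma n2_eq0 V (x : V) : n2 x = 0 -> x = 0.
Proof. by move=> x0; apply/eqP; rewrite -(dnorm_eq0 hdot) hdotxx x0. Qed.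

Lemma n20 V : n2 (0 : V) = 0.
Proof. by rewrite /n2 rdot0l. Qed.

Lemma n2D V (x y : V) : n2 (x + y) = n2 x + n2 y + 2 * rdot x y.
Proof. by rewrite /n2 rdotDl !rdotDr (rdotC y x); ring. Qed.

Lemma n2N V (x : V) : n2 (- x) = n2 x.
Proof. by rewrite /n2 rdotNl rdotNr opprK. Qed.

Lemma n2B V (x y : V) : n2 (x - y) = n2 x + n2 y - 2 * rdot x y.
Proof. by rewrite n2D n2N rdotNr mulrN. Qed.

Lemma n2Bsym V (x y : V) : n2 (x - y) = n2 (y - x).
Proof. by rewrite -n2N opprB. Qed.

Lemma n2Z V (c : R[i]) (x : V) :
  n2 (c *: x) = (complex.Re c ^+ 2 + complex.Im c ^+ 2) * n2 x.
Proof.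
apply: complexI; rewrite -hdotxx dnormZ hdotxx -add_Re2_Im2.
by rewrite [RHS]rmorphM.
Qed.

Lemma n2Zr V (r : R) (x : V) : n2 (r%:C *: x) = r ^+ 2 * n2 x.
Proof. by rewrite n2Z /= expr0n addr0. Qed.

Lemma n2i V (x : V) : n2 ('i *: x) = n2 x.
Proof. by rewrite n2Z /= expr0n add0r expr1n mul1r. Qed.

Lemma n2_le2 V (x y : V) : n2 (x + y) <= 2 * n2 x + 2 * n2 y.
Proof. by have := n2_ge0 (x - y); rewrite n2B n2D; lra. Qed.

Lemma n2_leB V (x y z : V) : n2 (x - z) <= 2 * n2 (x - y) + 2 * n2 (y - z).
Proof. by rewrite -(subrKA y) n2_le2. Qed.

Lemma rdot_le V (x y : V) : 2 * rdot x y <= n2 x + n2 y.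
Proof. by have := n2_ge0 (x - y); rewrite n2B; lra. Qed.

Lemma CauchySchwarz_rdot V (x y : V) : rdot x y ^+ 2 <= n2 x * n2 y.
Proof.
have [y0|y0] := eqVneq (n2 y) 0.
  by rewrite (n2_eq0 y0) rdot0r n20 mulr0 expr0n.
have yp : 0 < n2 y by rewrite lt_def y0 n2_ge0.
have := n2_ge0 ((n2 y)%:C *: x - (rdot x y)%:C *: y).
rewrite n2B !n2Zr rdotZl rdotZr => h.
rewrite -(ler_pM2l yp) -subr_ge0; apply: (le_trans h); rewrite le_eqVlt.
by apply/orP; left; apply/eqP; ring.
Qed.

Lemma rdot_inj V (x y : V) : (forall z, rdot x z = rdot y z) -> x = y.
Proof.
move=> h; apply/subr0_eq/n2_eq0.
by rewrite /n2 rdotDl rdotNl h subrr.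
Qed.

Lemma normE V (x : V) : `|x| = (Num.sqrt (n2 x))%:C.
Proof.
apply/eqP; rewrite -(@eqrXn2 _ 2) //; last by rewrite lecR sqrtr_ge0.
by rewrite -hdot_norm hdotxx -rmorphXn /= sqr_sqrtr ?n2_ge0.
Qed.

(** The library norm takes values in [R[i]]; convergence is therefore measured by [n2] and real
    tolerances, which the inner product controls directly. *)
Definition lim_seq V (u : nat -> V) (l : V) :=
  forall e : R, 0 < e -> exists N, forall n, (N <= n)%N -> n2 (u n - l) < e.

Lemma norm_lt V (x : V) (e : R) : 0 < e -> (`|x| < e%:C) = (n2 x < e ^+ 2).
Proof.
move=> e0; rewrite normE ltcR -(@ltr_pXn2r _ 2) ?nnegrE ?sqrtr_ge0 ?ltW //.
by rewrite sqr_sqrtr ?n2_ge0.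
Qed.

Lemma cvg_lim_seq V (u : nat -> V) l :
  u @ \oo --> l -> lim_seq u l.
Proof.
move=> ul e e0; have se0 : 0 < Num.sqrt e by rewrite sqrtr_gt0.
have /cvgrPdist_lt /(_ (Num.sqrt e)%:C) := ul.
rewrite ltcR => /(_ se0) [N _ hN]; exists N => n /hN /=.
by rewrite norm_lt // sqr_sqrtr ?ltW // n2Bsym.
Qed.

Lemma cauchy_lim_seq V (u : nat -> V) :
  (forall e : R, 0 < e -> exists N, forall m n, (N <= m)%N -> (N <= n)%N ->
    n2 (u m - u n) < e) -> exists l, lim_seq u l.
Proof.
move=> hu.
have /cauchy_cvgP/cvg_ex[l ul] : cauchy (u @ \oo).
  apply/cauchy_ballP => e e0.
  have Re0 : 0 < complex.Re e by move: e0; rewrite ltcE => /andP[].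
  have eE : e = (complex.Re e)%:C.
    by move: e0; rewrite ltcE => /andP[/eqP]; case: (e) => a b /= ->.
  have [|N hN] := hu (complex.Re e ^+ 2); first by rewrite exprn_gt0.
  exists ([set u n | n in [set n | (N <= n)%N]], [set u n | n in [set n | (N <= n)%N]]).
    split => /=; exists N => // n /= Nn; exists n => //.
  case=> x y /= [[m Nm <-] [n Nn <-]].
  by rewrite -ball_normE /= eE norm_lt // hN.
by exists l; exact: cvg_lim_seq.
Qed.


Lemma lim_seq_uniq V (u : nat -> V) l l' :
  lim_seq u l -> lim_seq u l' -> l = l'.
Proof.
move=> ul ul'; apply/subr0_eq/n2_eq0/le_anti.
rewrite n2_ge0 andbT; apply/ler_addgt0Pr => e e0; rewrite add0r.
have e4 : 0 < e / 4 by lra.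
have [N hN] := ul _ e4; have [N' hN'] := ul' _ e4.
apply: (le_trans (n2_leB l (u (maxn N N')) l')).
have := hN _ (leq_maxl N N'); have := hN' _ (leq_maxr N N').
by rewrite (n2Bsym l); lra.
Qed.

End RealInnerProduct.

(** * Riesz representation and adjoints *)

Section RieszRepresentation.
Context {R : realType}.
Implicit Type V W : hilbertType R.
Local Open Scope complex_scope.

(** [M] bounds squared norms, so it stands for the square of an operator norm bound; [bounded_opP]
    identifies this with continuity. *)
Definition bop V W (A : V -> W) : Prop :=
  linear A /\ exists2 M : R, 0 <= M & forall x, n2 (A x) <= M * n2 x.

(** The functional [n2 k - 2 * phi k] is bounded below on [K], and the limit of a minimizing
    sequence represents [phi]. As [K] need not be closed, that limit is only known to be approached
    from [K]. With [K] the whole space this gives Riesz representation; with [phi] the pairing with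
    a vector, the orthogonal projection. *)
Lemma minimizer V (K : set V) (phi : V -> R) (M : R) :
  K 0 -> (forall x y, K x -> K y -> K (x + y)) ->
  (forall (r : R) x, K x -> K (r%:C *: x)) ->
  (forall x y, K x -> K y -> phi (x + y) = phi x + phi y) ->
  (forall (r : R) x, K x -> phi (r%:C *: x) = r * phi x) ->
  0 <= M -> (forall k, K k -> phi k ^+ 2 <= M * n2 k) ->
  exists2 y, (exists2 u, lim_seq u y & forall n, K (u n)) &
    forall k, K k -> phi k = rdot k y.
Proof.
move=> K0 KD KZ phiD phiZ M0 phiM.
pose J k := n2 k - 2 * phi k.
have JM k : K k -> - M <= J k.
  move=> Kk; have := phiM k Kk; have := n2_ge0 k; rewrite /J => s0 hs.
  suff : 2 * phi k <= n2 k + M by lra.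
  have [|p0] := leP (phi k) 0; first by lra.
  rewrite -(@ler_pXn2r _ 2) ?nnegrE //; [|by lra|by lra].
  by have := sqr_ge0 (n2 k - M); nra.
pose S := [set J k | k in K].
have infS : has_inf S.
  by split; [exists (J 0), 0|exists (- M) => _ [k Kk <-]; exact: JM].
have Jinf k : K k -> inf S <= J k by move=> Kk; apply: ge_inf infS.2 _ _; exists k.
have e_gt0 n : 0 < n.+1%:R^-1 :> R by rewrite invr_gt0.
have /choice[u hu] : forall n, exists k, K k /\ J k < inf S + n.+1%:R^-1.
  by move=> n; have [_ [k Kk <-] ?] := inf_adherent (e_gt0 n) infS; exists k.
have Ku n : K (u n) by case: (hu n).
have Ju n : J (u n) < inf S + n.+1%:R^-1 by case: (hu n).
have eN (e : R) : 0 < e -> exists N, forall n, (N <= n)%N -> n.+1%:R^-1 < e.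
  move=> e0; have [N hN] := ltr_add_invr e0; exists N => n Nn.
  apply: le_lt_trans hN; rewrite add0r lef_pV2 ?posrE // ler_nat; lia.
(* Parallelogram identity: [n2 (u m - u n) = 2 J (u m) + 2 J (u n) - 4 J k] for the midpoint [k],
   and [J k] is at least the infimum. *)
have cauchy_u m n : n2 (u m - u n) <= 2 * (m.+1%:R^-1 + n.+1%:R^-1).
  have := Jinf _ (KZ (2^-1) _ (KD _ _ (Ku m) (Ku n))).
  have := Ju m; have := Ju n.
  rewrite /J n2Zr phiZ ?phiD //; [|exact: KD].
  rewrite n2B n2D (_ : 2^-1 ^+ 2 = 4^-1 :> R); last by field.
  by move: (m.+1%:R^-1) (n.+1%:R^-1) => a b; lra.
have [y uy] : exists y, lim_seq u y.
  apply: cauchy_lim_seq => e e0; have [|N hN] := eN (e / 4); first by lra.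
  exists N => m n /hN hm /hN hn; apply: le_lt_trans (cauchy_u m n) _.
  by move: hm hn; move: (m.+1%:R^-1) (n.+1%:R^-1) => a b; lra.
exists y; first by exists u.
move=> k Kk.
have hn n : (rdot k (u n) - phi k) ^+ 2 <= n.+1%:R^-1 * n2 k.
  have [k0|k0] := eqVneq (n2 k) 0.
    have := phiM _ Kk; rewrite (n2_eq0 k0) rdot0l n20 !mulr0 sub0r sqrrN.
    by [].
  have kp : 0 < n2 k by rewrite lt_def k0 n2_ge0.
  set d := rdot k (u n) - phi k.
  (* Adding [c] times [k] to [u n] changes [J] by [2 * c * d + c ^+ 2 * n2 k]; the coefficient
     [- d / n2 k] minimizes this, with value [- d ^+ 2 / n2 k]. *)
  have := Jinf _ (KD _ _ (Ku n) (KZ (- d / n2 k) _ Kk)).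
  have := Ju n.
  rewrite /J phiD ?phiZ //; [|exact: KZ].
  rewrite n2D n2Zr rdotZr (rdotC _ k).
  set a := J (u n) => h1 h2.
  have : 0 <= n.+1%:R^-1 + 2 * (- d / n2 k) * d + (- d / n2 k) ^+ 2 * n2 k.
    by move: h1 h2; rewrite -/d; move: (n.+1%:R^-1) (- d / n2 k) => b c; rewrite /d; lra.
  rewrite (_ : _ + _ + _ = n.+1%:R^-1 - d ^+ 2 / n2 k); last first.
    by move: (n.+1%:R^-1) => b; field.
  by rewrite subr_ge0 ler_pdivrMr.
apply/esym/eqP; rewrite -subr_eq0 -sqrf_eq0; apply/eqP/le_anti.
rewrite sqr_ge0 andbT; apply/ler_addgt0Pr => e e0; rewrite add0r.
pose s := n2 k + 1.
have s0 : 0 < s by rewrite ltr_wpDl ?n2_ge0.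
have es : 0 < e / (4 * s) by rewrite divr_gt0 // mulr_gt0.
have [N hN] := uy _ es; have [N' hN'] := eN _ es.
set n := maxn N N'.
have h1 := hN n (leq_maxl _ _); have h2 := hN' n (leq_maxr _ _).
have h3 := CauchySchwarz_rdot k (u n - y).
have := hn n.
have -> : rdot k y - phi k = (rdot k (u n) - phi k) - rdot k (u n - y).
  by rewrite rdotDr rdotNr; ring.
have h4 (a b : R) : (a - b) ^+ 2 <= 2 * a ^+ 2 + 2 * b ^+ 2.
  by have := sqr_ge0 (a + b); lra.
move=> h5; apply: le_trans (h4 _ _) _.
have k0 := n2_ge0 k.
have h6 : n.+1%:R^-1 * n2 k <= e / 4.
  have -> : e / 4 = e / (4 * s) * s by field; rewrite gt_eqF.
  by apply: ler_pM; rewrite ?n2_ge0 ?invr_ge0 ?ler0n 1?ltW // /s; lra.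
have h7 : n2 k * n2 (u n - y) <= e / 4.
  have -> : e / 4 = s * (e / (4 * s)) by field; rewrite gt_eqF.
  by apply: ler_pM; rewrite ?n2_ge0 1?ltW // /s; lra.
by have := le_trans h5 h6; have := le_trans h3 h7; clear; lra.
Qed.

Lemma riesz V (phi : V -> R) (M : R) :
  (forall x y, phi (x + y) = phi x + phi y) ->
  (forall (r : R) x, phi (r%:C *: x) = r * phi x) ->
  0 <= M -> (forall k, phi k ^+ 2 <= M * n2 k) ->
  exists y, forall k, phi k = rdot k y.
Proof.
move=> phiD phiZ M0 phiM.
have [//|y _ hy] := @minimizer V setT phi M I (fun _ _ _ _ => I)
  (fun _ _ _ => I) (fun _ _ _ _ => phiD _ _) (fun _ _ _ => phiZ _ _) M0.
by exists y => k; exact: hy.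
Qed.

Lemma complex_scaleE V (c : R[i]) (x : V) :
  c *: x = (complex.Re c)%:C *: x + (complex.Im c)%:C *: ('i *: x).
Proof. by rewrite scalerA -scalerDl {1}[c]complexE [_ * 'i]mulrC. Qed.

Lemma real_linear V W (A : V -> W) :
  (forall x y, A (x + y) = A x + A y) ->
  (forall (r : R) x, A (r%:C *: x) = r%:C *: A x) ->
  (forall x, A ('i *: x) = 'i *: A x) -> linear A.
Proof.
move=> AD AZ Ai c x y.
by rewrite AD complex_scaleE AD !AZ Ai [RHS]/= [in RHS]complex_scaleE.
Qed.

(** Riesz representation of each [s x] gives a real-linear map; the invariance of [s] under ['i]
    makes it complex linear. The bound comes from testing at [y = A x]. *)
Lemma form_operator V W (s : V -> W -> R) (M : R) :
  (forall x x' y, s (x + x') y = s x y + s x' y) ->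
  (forall x y y', s x (y + y') = s x y + s x y') ->
  (forall (r : R) x y, s (r%:C *: x) y = r * s x y) ->
  (forall (r : R) x y, s x (r%:C *: y) = r * s x y) ->
  (forall x y, s ('i *: x) ('i *: y) = s x y) ->
  0 <= M -> (forall x y, s x y ^+ 2 <= M * n2 x * n2 y) ->
  exists2 A : V -> W, bop A & forall x y, rdot (A x) y = s x y.
Proof.
move=> sDl sDr sZl sZr sii M0 sM.
have /choice[A hA] : forall x, exists z, forall y, s x y = rdot y z.
  move=> x; apply: (@riesz W (s x) (M * n2 x)) => //.
  by rewrite mulr_ge0 ?n2_ge0.
have {}hA x y : rdot (A x) y = s x y by rewrite rdotC.
exists A => //; split.
  apply: real_linear => [x y|r x|x]; apply: rdot_inj => z.
  - by rewrite rdotDl !hA sDl.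
  - by rewrite rdotZl !hA sZl.
  - rewrite rdot_il !hA -sii scaleii -scaleN1r.
    rewrite (_ : -1 = (-1)%:C) ?sZl ?mulN1r //.
    by apply/eqP; rewrite eq_complex /= oppr0 !eqxx.
exists M => // x; have := sM x (A x); rewrite -hA -/(n2 _) expr2.
have [->|Ax0] := eqVneq (n2 (A x)) 0; first by rewrite mulr_ge0 ?n2_ge0.
by rewrite ler_pM2r // lt_def Ax0 n2_ge0.
Qed.

End RieszRepresentation.

(** * Bounded operators, adjoints and orthogonal projections *)

Section BoundedOperators.
Context {R : realType}.
Implicit Type V W : hilbertType R.
Local Open Scope complex_scope.

Lemma bop_linear V W (A : V -> W) : bop A -> linear A.
Proof. by case. Qed.

Section Linear.
Context {V W : hilbertType R} {A : V -> W}.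
Hypothesis linA : linear A.

Lemma linD x y : A (x + y) = A x + A y.
Proof. by have := linA 1 x y; rewrite !scale1r. Qed.

Lemma lin0 : A 0 = 0.
Proof. by apply: (addrI (A 0)); rewrite -linD !addr0. Qed.

Lemma linZ c x : A (c *: x) = c *: A x.
Proof. by have := linA c x 0; rewrite lin0 !addr0. Qed.

Lemma linN x : A (- x) = - A x.
Proof. by rewrite -scaleN1r linZ scaleN1r. Qed.

Lemma linB x y : A (x - y) = A x - A y.
Proof. by rewrite linD linN. Qed.

End Linear.

Lemma bop_comp V W (U : hilbertType R) (A : W -> U) (B : V -> W) :
  bop A -> bop B -> bop (A \o B).
Proof.
move=> [lA [M M0 hM]] [lB [N N0 hN]]; split.
  by move=> c x y /=; rewrite lB lA.
exists (M * N) => [|x /=]; first exact: mulr_ge0.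
by rewrite (le_trans (hM _)) // -mulrA ler_wpM2l.
Qed.

Lemma bop_add V W (A B : V -> W) : bop A -> bop B -> bop (A \+ B).
Proof.
move=> [lA [M M0 hM]] [lB [N N0 hN]]; split.
  by move=> c x y /=; rewrite lA lB scalerDr addrACA.
exists (2 * M + 2 * N) => [|x /=]; first by lra.
by rewrite (le_trans (n2_le2 _ _)) //; have := hM x; have := hN x; lra.
Qed.

Lemma bop_scale V W c (A : V -> W) : bop A -> bop (fun x => c *: A x).
Proof.
move=> [lA [M M0 hM]]; split.
  by move=> d x y; rewrite lA scalerDr !scalerA [c * d]mulrC.
exists ((complex.Re c ^+ 2 + complex.Im c ^+ 2) * M).
  by rewrite mulr_ge0 // addr_ge0 ?sqr_ge0.
by move=> x; rewrite n2Z -mulrA ler_wpM2l // addr_ge0 ?sqr_ge0.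
Qed.

Lemma bop_opp V W (A : V -> W) : bop A -> bop (\- A).
Proof.
move=> /(bop_scale (-1)); rewrite (_ : (fun x => _) = \- A) //.
by apply/funext => x; rewrite scaleN1r.
Qed.

Lemma bop_sub V W (A B : V -> W) : bop A -> bop B -> bop (A \- B).
Proof. by move=> bA /bop_opp; exact: bop_add. Qed.

Lemma bop_id V : bop (@id V).
Proof. by split=> [//|]; exists 1 => // x; rewrite mul1r. Qed.

Lemma bop_zero V W : bop (fun _ : V => 0 : W).
Proof.
split=> [c x y|]; first by rewrite scaler0 addr0.
by exists 0 => // x; rewrite n20 mul0r.
Qed.

Lemma bounded_opP V W (A : V -> W) : bounded_op A <-> bop A.
Proof.
split=> -[lA].
  pose lAm := GRing.isLinear.Build _ _ _ _ A lA.
  pose A' : {linear V -> W} := HB.pack A lAm.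
  move=> cA; have /linear_boundedP : bounded_near A' (nbhs 0).
    exact/linear_bounded_continuous.
  move=> /pinfty_ex_gt0[M M0 hM].
  have MR : M = (complex.Re M)%:C.
    by move: M0; rewrite ltcE => /andP[/eqP]; case: (M) => a b /= ->.
  have RM0 : 0 <= complex.Re M by move: M0; rewrite ltcE => /andP[_ /ltW].
  split => //; exists (complex.Re M ^+ 2) => [|x]; first exact: sqr_ge0.
  have := hM x; rewrite !normE MR -rmorphM lecR.
  rewrite -(@ler_pXn2r _ 2) ?nnegrE ?mulr_ge0 ?sqrtr_ge0 //.
  by rewrite exprMn !sqr_sqrtr ?n2_ge0.
move=> [M M0 hM]; split => //.
pose lAm := GRing.isLinear.Build _ _ _ _ A lA.
pose A' : {linear V -> W} := HB.pack A lAm.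
suff : continuous A' by [].
apply/linear_bounded_continuous/bounded_funP => r.
exists ((Num.sqrt M)%:C * r) => x xr.
apply: (@le_trans _ _ ((Num.sqrt M)%:C * `|x|)).
  by rewrite !normE -rmorphM lecR -sqrtrM // ler_wsqrtr.
by rewrite ler_wpM2l // lecR sqrtr_ge0.
Qed.

Lemma adjoint_exists V W (A : V -> W) : bop A ->
  exists2 B : W -> V, bop B & forall x y, rdot (A x) y = rdot x (B y).
Proof.
move=> [lA [M M0 hM]].
have [|||||| |B bB hB] := @form_operator R W V (fun y x => rdot y (A x)) M.
- by move=> *; rewrite rdotDl.
- by move=> *; rewrite linD // rdotDr.
- by move=> *; rewrite rdotZl.
- by move=> *; rewrite linZ // rdotZr.
- by move=> *; rewrite linZ // rdot_ii.
- by [].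
- move=> y x; rewrite (le_trans (CauchySchwarz_rdot _ _)) //.
  rewrite mulrAC [leRHS]mulrC ler_wpM2l ?n2_ge0 //.
by exists B => // x y; rewrite rdotC -hB rdotC.
Qed.

(** [P x] represents the pairing with [x] on [K], and closedness puts it in [K]. Linearity follows
    because membership in [K] and orthogonality of the remainder determine [P x]. *)
Lemma projection V (K : set V) :
  K 0 -> (forall x y, K x -> K y -> K (x + y)) ->
  (forall c x, K x -> K (c *: x)) ->
  (forall u l, lim_seq u l -> (forall n, K (u n)) -> K l) ->
  exists2 P : V -> V, bop P &
    forall x, K (P x) /\ forall k, K k -> rdot k (x - P x) = 0.
Proof.
move=> K0 KD KZ Kcl.
have /choice[P hP] : forall x, exists y, K y /\ forall k, K k -> rdot k (x - y) = 0.
  move=> x; have [|||||||y [u uy Ku] hy] := @minimizer R V K (rdot x) (n2 x).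
  - by [].
  - exact: KD.
  - by move=> r; exact: KZ.
  - by move=> *; rewrite rdotDr.
  - by move=> *; rewrite rdotZr.
  - exact: n2_ge0.
  - by move=> k _; exact: CauchySchwarz_rdot.
  exists y; split; first exact: Kcl uy Ku.
  by move=> k Kk; rewrite rdotDr rdotNr -hy // rdotC subrr.
have uniq x y : K y -> (forall k, K k -> rdot k (x - y) = 0) -> P x = y.
  move=> Ky hy; apply/subr0_eq/n2_eq0.
  have [KP oP] := hP x.
  have KPy : K (P x - y) by rewrite -scaleN1r; apply: KD => //; exact: KZ.
  have := oP _ KPy; have := hy _ KPy; rewrite /n2 !rdotDr !rdotNr; lra.
exists P => //; split.
  move=> c x y; apply: uniq => [|k Kk]; first by apply: KD; [apply: KZ|]; exact: (hP _).1.
  rewrite opprD addrACA -scalerBr rdotDr (hP y).2 // addr0.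
  rewrite complex_scaleE rdotDr !rdotZr (hP x).2 // mulr0 add0r.
  by rewrite -[rdot k _]opprK -rdot_il (hP x).2 ?oppr0 ?mulr0 //; exact: KZ.
exists 1 => // x; rewrite mul1r.
have [KP oP] := hP x; have := oP _ KP; rewrite rdotDr rdotNr => h.
have := n2_ge0 (x - P x); rewrite n2B (rdotC x); rewrite /n2 in h *; lra.
Qed.

End BoundedOperators.

(** * Positive operators and their square roots *)

Section PositiveOperators.
Context {R : realType}.
Implicit Type V W : hilbertType R.
Local Open Scope complex_scope.

Definition nrm V (x : V) : R := Num.sqrt (n2 x).

Lemma nrm_ge0 V (x : V) : 0 <= nrm x.
Proof. exact: sqrtr_ge0. Qed.

Lemma nrm_sqr V (x : V) : nrm x ^+ 2 = n2 x.
Proof. by rewrite sqr_sqrtr ?n2_ge0. Qed.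

Lemma nrmD V (x y : V) : nrm (x + y) <= nrm x + nrm y.
Proof. by have := ler_normD x y; rewrite !normE -rmorphD lecR. Qed.

Lemma nrmZ V (r : R) (x : V) : 0 <= r -> nrm (r%:C *: x) = r * nrm x.
Proof. by move=> r0; rewrite /nrm n2Zr sqrtrM ?sqr_ge0 // sqrtr_sqr ger0_norm. Qed.

Lemma nrm_le V (x y : V) c : 0 <= c -> (nrm x <= c * nrm y) = (n2 x <= c ^+ 2 * n2 y).
Proof.
move=> c0; rewrite -(@ler_pXn2r _ 2) ?nnegrE ?mulr_ge0 ?nrm_ge0 //.
by rewrite exprMn !nrm_sqr.
Qed.

Lemma lim_seq_cvg V (u : nat -> V) l z :
  lim_seq u l -> (fun n => rdot (u n) z) @ \oo --> rdot l z.
Proof.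
move=> ul; apply/cvgrPdist_lt => e e0.
have s0 : 0 < n2 z + 1 by rewrite ltr_wpDl ?n2_ge0.
have [|N hN] := ul (e ^+ 2 / (n2 z + 1)); first by rewrite divr_gt0 ?exprn_gt0.
exists N => // n /= /hN; rewrite ltr_pdivlMr // => h.
rewrite -(@ltr_pXn2r _ 2) ?nnegrE ?normr_ge0 ?(ltW e0) // real_normK ?num_real //.
rewrite -sqrrN opprB -rdotNl -rdotDl.
apply: le_lt_trans (CauchySchwarz_rdot _ _) _; apply: le_lt_trans h.
by rewrite ler_wpM2l ?n2_ge0 //; lra.
Qed.

Lemma lim_seq_eq V W (u : nat -> V) l z (v : nat -> W) m w :
  lim_seq u l -> lim_seq v m -> (forall n, rdot (u n) z = rdot (v n) w) ->
  rdot l z = rdot m w.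
Proof.
move=> /(@lim_seq_cvg _ _ _ z) ul /(@lim_seq_cvg _ _ _ w) vm uv.
have uvE : (fun n => rdot (u n) z) = (fun n => rdot (v n) w) by exact/funext.
by move: ul; rewrite uvE => ul; exact: cvg_unique ul vm.
Qed.

Lemma lim_seq_rdot_le V (u : nat -> V) l z c :
  lim_seq u l -> (forall n, rdot (u n) z <= c) -> rdot l z <= c.
Proof.
move=> /(@lim_seq_cvg _ _ _ z) ul h.
rewrite -(cvg_lim _ ul) //; apply: limr_le; first by apply/cvg_ex; exists (rdot l z).
by apply: nearW.
Qed.

Lemma lim_seq_n2_le V (u : nat -> V) l c :
  lim_seq u l -> (forall n, n2 (u n) <= c) -> n2 l <= c.
Proof.
(* Pairing with [l] itself makes the bound linear in [u n]:
   [2 * rdot (u n) l <= n2 (u n) + n2 l]. *)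
move=> ul h; suff : n2 l <= (c + n2 l) / 2 by lra.
apply: lim_seq_rdot_le ul _ => n.
by have := rdot_le (u n) l; have := h n; lra.
Qed.

Lemma eq_lim_seq V (u v : nat -> V) l :
  (forall n, u n = v n) -> lim_seq u l -> lim_seq v l.
Proof. by move=> /funext ->. Qed.

Lemma lim_seq_add V (u v : nat -> V) l m :
  lim_seq u l -> lim_seq v m -> lim_seq (fun n => u n + v n) (l + m).
Proof.
move=> ul vm e e0; have e4 : 0 < e / 4 by lra.
have [N hN] := ul _ e4; have [N' hN'] := vm _ e4.
exists (maxn N N') => n; rewrite geq_max => /andP[/hN h /hN' h'].
by rewrite opprD addrACA (le_lt_trans (n2_le2 _ _)) //; lra.
Qed.

Lemma lim_seq_bop V W (A : V -> W) (u : nat -> V) l :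
  bop A -> lim_seq u l -> lim_seq (fun n => A (u n)) (A l).
Proof.
move=> [lA [M M0 hM]] ul e e0.
have s0 : 0 < M + 1 by lra.
have [|N hN] := ul (e / (M + 1)); first by rewrite divr_gt0.
exists N => n /hN; rewrite ltr_pdivlMr // => h; rewrite -linB //.
by rewrite (le_lt_trans (hM _)) //; have := n2_ge0 (u n - l); lra.
Qed.

Lemma lim_seq_shift V (u : nat -> V) l :
  lim_seq u l -> lim_seq (fun n => u n.+1) l.
Proof.
move=> ul e /ul[N hN]; exists N => n Nn; apply: hN; exact: leqW.
Qed.

Lemma lim_seq_cst V (l : V) : lim_seq (fun=> l) l.
Proof. by move=> e e0; exists 0%N => n _; rewrite subrr n20. Qed.

Definition selfadj V (A : V -> V) := forall x y, rdot (A x) y = rdot x (A y).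

Definition pos V (A : V -> V) :=
  [/\ bop A, selfadj A & forall x, 0 <= rdot (A x) x].

Lemma pos_bop V (A : V -> V) : pos A -> bop A. Proof. by case. Qed.
Lemma pos_selfadj V (A : V -> V) : pos A -> selfadj A. Proof. by case. Qed.
Lemma pos_lin V (A : V -> V) : pos A -> linear A. Proof. by case=> -[]. Qed.
Lemma pos_rdot V (A : V -> V) : pos A -> forall x, 0 <= rdot (A x) x.
Proof. by case. Qed.

(** Complex positivity forces self-adjointness: [rdot (A z) ('i *: z)] vanishes for every [z], and
    expanding it at [z = x + 'i *: y] compares [rdot (A x) y] with [rdot (A y) x]. *)
Lemma pos_opP V (A : V -> V) : pos_op A <-> pos A.
Proof.
split=> [[/bounded_opP bA A0]|[bA sA A0]]; last first.
  split; first exact/bounded_opP.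
  move=> x; rewrite hdotE lecE /= A0 andbT.
  have := sA x ('i *: x); rewrite linZ; last exact: bop_linear.
  have -> : rdot x ('i *: A x) = - rdot (A x) ('i *: x).
    by rewrite rdotC rdot_il.
  by move=> h; apply/eqP; lra.
have Re0 x : 0 <= rdot (A x) x by have := A0 x; rewrite lecE => /andP[].
have Im0 x : rdot (A x) ('i *: x) = 0 by rewrite -Im_hdot ger0_Im.
split=> // x y; have lA := bop_linear bA.
have := Im0 (x + 'i *: y).
rewrite scalerDr scaleii linD // linZ // !rdotDl !rdotDr !rdotNr Im0.
by rewrite rdot_ii (rdot_il _ y) Im0 (rdotC x); lra.
Qed.

Lemma pos_add V (A B : V -> V) : pos A -> pos B -> pos (A \+ B).
Proof.
move=> [bA sA A0] [bB sB B0]; split; first exact: bop_add.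
  by move=> x y /=; rewrite rdotDl rdotDr sA sB.
by move=> x /=; rewrite rdotDl addr_ge0.
Qed.

Lemma pos_scale V (r : R) (A : V -> V) :
  0 <= r -> pos A -> pos (fun x => r%:C *: A x).
Proof.
move=> r0 [bA sA A0]; split; first exact: bop_scale.
  by move=> x y /=; rewrite rdotZl rdotZr sA.
by move=> x /=; rewrite rdotZl mulr_ge0.
Qed.

Lemma pos_square V (A : V -> V) : bop A -> selfadj A -> pos (A \o A).
Proof.
move=> bA sA; split; first exact: bop_comp.
  by move=> x y /=; rewrite !sA.
by move=> x /=; rewrite sA n2_ge0.
Qed.

Lemma pos_conj V W (A : V -> V) (B : W -> V) (B' : V -> W) :
  pos A -> bop B -> bop B' -> (forall x y, rdot (B x) y = rdot x (B' y)) ->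
  pos (B' \o A \o B).
Proof.
move=> [bA sA A0] bB bB' BB'; split.
- by apply: bop_comp => //; exact: bop_comp.
- by move=> x y /=; rewrite rdotC -BB' rdotC -BB' sA rdotC.
- by move=> x /=; rewrite rdotC -BB' rdotC.
Qed.

(** This is [A ^ 2 <= N A] for any [N > 0] bounding the quadratic form of [A]: positivity is tested
    at [x - N^-1 A x]. The value [(M + 1) / 2] comes from [2 * rdot (A y) y <= n2 (A y) + n2 y]. *)
Lemma pos_n2_le V (A : V -> V) : pos A ->
  exists2 N : R, 0 < N & forall x, n2 (A x) <= N * rdot (A x) x.
Proof.
move=> [[lA [M M0 hM]] sA A0]; exists ((M + 1) / 2); first by lra.
set N := (M + 1) / 2; move=> x.
have N0 : 0 < N by rewrite /N; lra.
have hN y : rdot (A y) y <= N * n2 y.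
  by rewrite /N; have := rdot_le (A y) y; have := hM y; lra.
have := A0 (x - (N^-1)%:C *: A x); have := hN (A x).
rewrite linB // linZ // !rdotDl !rdotDr !rdotNl !rdotNr !rdotZl !rdotZr opprK.
rewrite (sA (A x) x) -!/(n2 (A x)) => h1 h2.
have h3 : N^-1 * (N^-1 * rdot (A (A x)) (A x)) <= N^-1 * n2 (A x).
  by rewrite ler_pM2l ?invr_gt0 // mulrC ler_pdivrMr // mulrC.
rewrite mulrC -ler_pdivrMr // mulrC.
by move: h2 h3; move: (N^-1) => c; lra.
Qed.

Lemma pos_eq0 V (A : V -> V) x : pos A -> rdot (A x) x = 0 -> A x = 0.
Proof.
move=> /pos_n2_le[N N0 hN] h; apply/n2_eq0/le_anti; rewrite n2_ge0 andbT.
by rewrite (le_trans (hN _)) // h mulr0.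
Qed.

(** * The square root of [1 - C] by successive approximation *)

Section SquareRoot.
Context {V : hilbertType R}.
Variable C : V -> V.
Hypotheses (bC : bop C) (sC : selfadj C) (C1 : forall x, n2 (C x) <= n2 x).

(** A fixed point [L = (C + L ^ 2) / 2] satisfies [(1 - L) ^ 2 = 1 - C], so the root is [1 - L].
    Each [Y n] is a polynomial in [C], hence whatever commutes with [C] commutes with the limit. *)
Let Y := fix Y n : V -> V :=
  if n is n'.+1 then fun x => (2^-1)%:C *: (C x + Y n' (Y n' x)) else fun=> 0.
(** The same iteration with [C] replaced by [1]. It majorizes the norms of the [Y n] and of their
    increments; being monotone and at most [1], it makes [Y n x] a Cauchy sequence without any order
    on operators. *)
Let y := fix y n : R := if n is n'.+1 then 2^-1 * (1 + y n' ^+ 2) else 0.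

Let y01 n : 0 <= y n <= 1.
Proof. by elim: n => [|n /andP[h1 h2]] /=; [lra|nra]. Qed.

Let yS n : y n <= y n.+1.
Proof. by have := sqr_ge0 (y n - 1); rewrite /=; nra. Qed.

Let ymono m n : (m <= n)%N -> y m <= y n.
Proof. by move: m n; apply: (@homo_leq _ y <=%R) => //; exact: le_trans. Qed.

Let bY n : bop (Y n).
Proof.
elim: n => [|n IH] /=; first exact: bop_zero.
by apply: bop_scale; apply: bop_add => //; exact: bop_comp.
Qed.

Let lY n : linear (Y n).
Proof. exact: bop_linear (bY n). Qed.

Let sY n : selfadj (Y n).
Proof.
elim: n => [|n IH] x x' /=; first by rewrite rdot0l rdot0r.
by rewrite rdotZl rdotZr rdotDl rdotDr sC !IH.
Qed.

Let nY n x : nrm (Y n x) <= y n * nrm x.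
Proof.
elim: n x => [|n IH] x /=; first by rewrite /nrm n20 sqrtr0 mul0r.
have /andP[yn0 yn1] := y01 n.
rewrite nrmZ // -mulrA ler_wpM2l // (le_trans (nrmD _ _)) //.
rewrite mulrDl mul1r lerD //; first by rewrite -[leRHS]mul1r nrm_le // expr1n mul1r.
by rewrite (le_trans (IH _)) // expr2 -mulrA ler_wpM2l.
Qed.

Let dY n x : nrm (Y n.+1 x - Y n x) <= (y n.+1 - y n) * nrm x.
Proof.
elim: n x => [|n IH] x.
  have -> : Y 1 x - Y 0 x = (2^-1)%:C *: C x by rewrite /= addr0 subr0.
  rewrite nrmZ // /= expr0n /= addr0 mulr1 subr0 ler_wpM2l //.
  by rewrite -[leRHS]mul1r nrm_le // expr1n mul1r.
(* The difference of squares is split as [Y' (Y' - Y) + (Y' - Y) Y], which involves no commutation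
   and has the same shape for the scalars. *)
have -> : Y n.+2 x - Y n.+1 x =
    (2^-1)%:C *: (Y n.+1 (Y n.+1 x - Y n x) + (Y n.+1 (Y n x) - Y n (Y n x))).
  rewrite (linB (lY n.+1)) addrA subrK.
  rewrite -[Y n.+2 x]/((2^-1)%:C *: (C x + Y n.+1 (Y n.+1 x))).
  rewrite -[X in _ - X]/((2^-1)%:C *: (C x + Y n (Y n x))).
  by rewrite -scalerBr opprD addrACA subrr add0r.
rewrite nrmZ //.
have -> : y n.+2 - y n.+1 =
    2^-1 * (y n.+1 * (y n.+1 - y n) + (y n.+1 - y n) * y n).
  have yE k : y k.+1 = 2^-1 * (1 + y k ^+ 2) by [].
  by rewrite (yE n.+1) (yE n); move: (y n) => b; field.
rewrite -mulrA ler_wpM2l // (le_trans (nrmD _ _)) // mulrDl lerD //.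
  rewrite (le_trans (nY _ _)) // -mulrA ler_wpM2l //.
  by have /andP[] := y01 n.+1.
rewrite (le_trans (IH _)) // -mulrA ler_wpM2l //.
by rewrite subr_ge0.
Qed.

Let ddY m n x : (m <= n)%N -> nrm (Y n x - Y m x) <= (y n - y m) * nrm x.
Proof.
elim: n => [|n IH].
  by rewrite leqn0 => /eqP ->; rewrite !subrr mul0r /nrm n20 sqrtr0.
rewrite leq_eqVlt => /orP[/eqP -> |/IH h].
  by rewrite !subrr mul0r /nrm n20 sqrtr0.
rewrite -(subrKA (Y n x)) -(subrKA (y n)) (le_trans (nrmD _ _)) // mulrDl.
by rewrite lerD.
Qed.

Let Ylim x : exists l, lim_seq (fun n => Y n x) l.
Proof.
apply: cauchy_lim_seq => e e0.
have cy : cvgn y.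
  apply: nondecreasing_is_cvgn; first by move=> m n; exact: ymono.
  by exists 1 => _ [n _ <-]; have /andP[] := y01 n.
have s0 : 0 < 4 * (n2 x + 1) by rewrite mulr_gt0 // ltr_wpDl ?n2_ge0.
have [l yl] : exists l : R, y @ \oo --> l by exists (limn y).
have d0 : 0 < Num.sqrt (e / (4 * (n2 x + 1))) by rewrite sqrtr_gt0 divr_gt0.
have /cvgrPdist_lt/(_ _ d0)[N _ hN] := yl.
set d := Num.sqrt _ in d0 hN.
have dE : d ^+ 2 * (4 * (n2 x + 1)) = e.
  by rewrite sqr_sqrtr ?divfK ?gt_eqF // divr_ge0 // ltW.
have {hN}hN m n : (N <= m)%N -> (m <= n)%N -> n2 (Y n x - Y m x) < e.
  move=> Nm mn; rewrite -nrm_sqr.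
  have h : y n - y m < 2 * d.
    have := hN m Nm; have := hN n (leq_trans Nm mn).
    by rewrite /= !ltr_norml => /andP[? ?] /andP[? ?]; lra.
  apply: (@le_lt_trans _ _ ((2 * d) ^+ 2 * n2 x)).
    rewrite nrm_sqr -nrm_le; last by rewrite mulr_ge0 // ltW.
    apply: le_trans (ddY _ mn) _.
    by rewrite ler_wpM2r ?nrm_ge0 // ltW.
  have -> : e = (2 * d) ^+ 2 * (n2 x + 1) by rewrite -dE; ring.
  by rewrite ltr_pM2l ?exprn_gt0 ?mulr_gt0 //; lra.
exists N => m n Nm Nn; have [mn|/ltnW nm] := leqP m n.
  by rewrite n2Bsym; exact: hN.
exact: hN.
Qed.

Lemma unit_sqrt_exists : exists2 B : V -> V, pos B &
  (forall x, B (B x) = x - C x) /\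
  forall T : V -> V, bop T -> (forall x, T (C x) = C (T x)) ->
    forall x, T (B x) = B (T x).
Proof.
have /choice[L hL] := Ylim.
have LD x x' : L (x + x') = L x + L x'.
  apply: lim_seq_uniq (hL _) _.
  apply: eq_lim_seq (lim_seq_add (hL x) (hL x')) => n.
  by rewrite (linD (lY n)).
have LZ c x : L (c *: x) = c *: L x.
  apply: lim_seq_uniq (hL _) _.
  apply: eq_lim_seq (lim_seq_bop (bop_scale c (bop_id V)) (hL x)) => n.
  by rewrite (linZ (lY n)).
have lL : linear L by move=> c x x'; rewrite LD LZ.
have Y1 n x : n2 (Y n x) <= n2 x.
  rewrite -[leRHS]mul1r -(expr1n _ 2) -nrm_le // (le_trans (nY _ _)) //.
  by rewrite ler_wpM2r ?nrm_ge0 //; have /andP[] := y01 n.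
have L1 x : n2 (L x) <= n2 x by apply: lim_seq_n2_le (hL x) _ => n; exact: Y1.
have bL : bop L by split => //; exists 1 => // x; rewrite mul1r.
have sL : selfadj L.
  move=> x x'; rewrite [RHS]rdotC.
  by apply: lim_seq_eq (hL x) (hL x') _ => n; rewrite sY rdotC.
have LL x : L x + L x = C x + L (L x).
  have h : lim_seq (fun n => Y n (Y n x)) (L (L x)).
    move=> e e0; have e4 : 0 < e / 4 by lra.
    have [N hN] := hL x _ e4; have [N' hN'] := hL (L x) _ e4.
    exists (maxn N N') => n; rewrite geq_max => /andP[/hN h /hN' h'].
    apply: le_lt_trans (n2_leB _ (Y n (L x)) _) _.
    rewrite -(linB (lY n)).
    by have := Y1 n (Y n x - L x); lra.
  have := lim_seq_shift (hL x).
  move=> /(lim_seq_bop (bop_scale (2 : R)%:C (bop_id V))) /lim_seq_uniq.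
  have -> : (2 : R)%:C *: L x = L x + L x.
    by rewrite mulr2n rmorphD rmorph1 scalerDl scale1r.
  apply; apply: eq_lim_seq (lim_seq_add (lim_seq_cst _) h) => n.
  by rewrite scalerA -rmorphM divff ?pnatr_eq0 // scale1r.
exists (fun x => x - L x); last split.
- split; first by apply: bop_sub bL; exact: bop_id.
    by move=> x x'; rewrite rdotDl rdotDr rdotNl rdotNr sL.
  by move=> x; rewrite rdotDl rdotNl; have := rdot_le (L x) x; have := L1 x; rewrite /n2; lra.
- move=> x; rewrite linB // opprB addrA -addrA.
  have -> : C x = L x + L x - L (L x) by rewrite LL addrK.
  rewrite opprB addrA [in RHS]opprD; rewrite !addrA; congr (_ + _).
  by rewrite addrAC.
- move=> T bT TC x; have lT := bop_linear bT; rewrite (linB lT).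
  congr (_ - _); apply: lim_seq_uniq (lim_seq_bop bT (hL x)) _.
  suff TY n x' : T (Y n x') = Y n (T x').
    by apply: eq_lim_seq (hL (T x)) => n; rewrite TY.
  elim: n x' => [|n IH] x' /=; first by rewrite lin0.
  by rewrite (linZ lT) (linD lT) TC !IH.
Qed.

End SquareRoot.

(** Rescaling: [C = 1 - A / N] is a contraction by [pos_n2_le], and [A = N (1 - C)]. Uniqueness of
    the root and the Jordan decomposition rely on the commutation clause. *)
Lemma sqrt_exists V (A : V -> V) : pos A -> exists2 B : V -> V, pos B &
  (forall x, B (B x) = A x) /\
  forall T : V -> V, bop T -> (forall x, T (A x) = A (T x)) ->
    forall x, T (B x) = B (T x).
Proof.
move=> pA; have [bA sA A0] := pA; have [N N0 hN] := pos_n2_le pA.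
pose C x := x - (N^-1)%:C *: A x.
have bC : bop C by apply: bop_sub; [exact: bop_id|exact: bop_scale].
have sC : selfadj C.
  by move=> x y; rewrite rdotDl rdotDr rdotNl rdotNr rdotZl rdotZr sA.
have C1 x : n2 (C x) <= n2 x.
  rewrite n2B n2Zr rdotZr (rdotC x) expr2 -mulrA.
  have : N^-1 * (N^-1 * n2 (A x)) <= N^-1 * rdot (A x) x.
    by rewrite ler_pM2l ?invr_gt0 // mulrC ler_pdivrMr // mulrC.
  have : 0 <= N^-1 * rdot (A x) x by rewrite mulr_ge0 // invr_ge0 ltW.
  by move: (N^-1 * rdot _ _) (N^-1 * (N^-1 * _)) => a b; lra.
have [B pB [BB BT]] := unit_sqrt_exists bC sC C1.
have lB := pos_lin pB.
exists (fun x => (Num.sqrt N)%:C *: B x); first by apply: pos_scale => //; exact: sqrtr_ge0.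
split=> [x|T bT TA x].
  rewrite linZ // scalerA -rmorphM -expr2 sqr_sqrtr ?ltW // BB /C opprB addrC subrK.
  by rewrite scalerA -rmorphM divff ?gt_eqF // scale1r.
have lT := bop_linear bT; rewrite (linZ lT) BT //.
by move=> x'; rewrite /C (linB lT) (linZ lT) TA.
Qed.

(* [B] is the root given by [sqrt_exists]: it commutes with [B'], because [B']
   commutes with [B' \o B']. *)
Lemma sqrt_uniq V (A B B' : V -> V) :
  pos B -> (forall x, B (B x) = A x) ->
  (forall T : V -> V, bop T -> (forall x, T (A x) = A (T x)) ->
    forall x, T (B x) = B (T x)) ->
  pos B' -> (forall x, B' (B' x) = A x) -> B' = B.
Proof.
move=> pB BB BT pB' BB'.
have comm x : B' (B x) = B (B' x).
  by apply: BT; [exact: pos_bop|move=> x'; rewrite -!BB'].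
have [lB lB'] := (pos_lin pB, pos_lin pB').
apply/funext => x; apply/subr0_eq/n2_eq0.
set z := B' x - B x.
have z0 : B' z + B z = 0.
  by rewrite (linB lB') (linB lB) BB BB' comm addrA subrK subrr.
have : rdot (B' z) z + rdot (B z) z = 0 by rewrite -rdotDl z0 rdot0l.
have := pos_rdot pB z; have := pos_rdot pB' z => h1 h2 h3.
have Bz : B z = 0 by apply: pos_eq0 => //; lra.
have B'z : B' z = 0 by apply: pos_eq0 => //; lra.
rewrite /n2 {2}/z rdotDr rdotNr -!pos_selfadj // Bz B'z !rdot0l subrr //.
Qed.

End PositiveOperators.

(** * Orthonormal bases and traces *)

Section OrthonormalBases.
Context {R : realType}.
Implicit Type V W : hilbertType R.
Local Open Scope complex_scope.

Definition orthonormal_set V (B : set V) :=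
  forall u v, B u -> B v -> hdot u v = (u == v)%:R.

Lemma basis_exists V : exists B : set V, orthonormal_basis B.
Proof.
have [F FP totF|A [oA maxA]] := @Zorn_bigcup V (@orthonormal_set V).
  move=> u v [X FX Xu] [Y FY Yv].
  have [XY|YX] := totF _ _ FX FY.
    by apply: (FP _ FY) => //; exact: XY.
  by apply: (FP _ FX) => //; exact: YX.
exists A; split => // x xA; apply: contrapT => /eqP x0.
have n0 : 0 < nrm x.
  rewrite sqrtr_gt0 lt_def n2_ge0 andbT; apply/eqP => /n2_eq0 xE.
  by move: x0; rewrite xE eqxx.
pose x' := ((nrm x)^-1)%:C *: x.
have x'A u : A u -> hdot x' u = 0 by move=> Au; rewrite hdotZl xA // mulr0.
have x'x' : hdot x' x' = 1.
  by rewrite hdotxx n2Zr -nrm_sqr -exprMn mulVf ?gt_eqF // expr1n.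
have nAx' : ~ A x' by move=> /x'A; rewrite x'x' => /eqP; rewrite oner_eq0.
apply: (maxA (A `|` [set x'])).
  by split; [exact: subsetUl|move=> h; apply: nAx'; apply: h; right].
move=> u v [Au|->] [Av|->].
- exact: oA.
- rewrite hdotC x'A // conjc0; case: eqP => // uE; case: nAx'; by rewrite -uE.
- rewrite x'A //; case: eqP => // vE; case: nAx'; by rewrite vE.
- by rewrite x'x' eqxx.
Qed.

Lemma hbasisP V : orthonormal_basis (hbasis V).
Proof. by rewrite /hbasis; have [B hB] := basis_exists V; apply: (xgetPex _ _); exists B. Qed.

(** This is [|<x, b>|^2] as a real number; the second term is the square of the imaginary part, by
    [Im_hdot]. *)
Definition coef2 V (x b : V) : R := rdot x b ^+ 2 + rdot x ('i *: b) ^+ 2.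

Lemma coef2_ge0 V (x b : V) : 0 <= coef2 x b.
Proof. by rewrite addr_ge0 ?sqr_ge0. Qed.

Lemma coef2C V (x b : V) : coef2 x b = coef2 b x.
Proof. by rewrite /coef2 (rdotC b x) (rdotC x ('i *: b)) rdot_il sqrrN. Qed.

Lemma coef2_hdot V (x b : V) : hdot x b * (hdot x b)^*%C = (coef2 x b)%:C.
Proof.
rewrite hdotE /coef2; apply/eqP; rewrite eq_complex /=.
by apply/andP; split; apply/eqP; ring.
Qed.

Lemma coef2_le V (x b : V) : coef2 x b <= n2 x * n2 b.
Proof.
have [->|q0] := eqVneq (coef2 x b) 0; first by rewrite mulr_ge0 ?n2_ge0.
have q1 : 0 < coef2 x b by rewrite lt_def q0 coef2_ge0.
(* The multiple [<x, b> b] of [b] has a real pairing with [x], equal to [coef2 x b]. *)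
have := CauchySchwarz_rdot x (hdot x b *: b).
rewrite {1}/rdot hdotZr mulrC coef2_hdot /= n2Z {2}hdotE /= -Im_hdot.
rewrite [_ + _ ^+ 2](_ : _ = coef2 x b); last by rewrite /coef2 Im_hdot.
by rewrite expr2 mulrCA ler_pM2l.
Qed.

Lemma coef2_adj V W (A : V -> W) (A' : W -> V) x b : linear A' ->
  (forall x y, rdot (A x) y = rdot x (A' y)) -> coef2 (A x) b = coef2 x (A' b).
Proof. by move=> lA' AA'; rewrite /coef2 !AA' (linZ lA'). Qed.

Definition partial_exp V (s : seq V) (x : V) := \sum_(b <- s) hdot x b *: b.

(** * Bessel's inequality and best approximation *)

Section Bessel.
Context {V : hilbertType R} (B : set V).
Hypothesis oB : orthonormal_set B.

Lemma hdot_partial (s : seq V) x b : uniq s -> (forall b, b \in s -> B b) ->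
  b \in s -> hdot (partial_exp s x) b = hdot x b.
Proof.
move=> us sB bs; have Bb := sB _ bs.
rewrite hdot_suml (bigD1_seq b) //= hdotZl (oB Bb Bb) eqxx mulr1.
rewrite big_seq_cond big1 ?addr0 // => b' /andP[b's b'b].
by rewrite hdotZl (oB (sB _ b's) Bb) (negPf b'b) mulr0.
Qed.

Lemma hdot_comb (s : seq (R[i] * V)) (z : V) :
  (forall p, p \in s -> hdot z p.2 = 0) ->
  hdot z (\sum_(p <- s) p.1 *: p.2) = 0.
Proof.
move=> h; rewrite hdot_sumr big_seq big1 // => p ps.
by rewrite hdotZr h // mulr0.
Qed.

Lemma n2_partial (s : seq V) x : uniq s -> (forall b, b \in s -> B b) ->
  n2 (partial_exp s x) = \sum_(b <- s) coef2 x b.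
Proof.
move=> us sB; apply: complexI; rewrite -hdotxx {2}/partial_exp hdot_sumr.
rewrite rmorph_sum /= big_seq [RHS]big_seq; apply: eq_bigr => b bs.
by rewrite hdotZr hdot_partial // mulrC coef2_hdot.
Qed.

Lemma n2_residual (s : seq V) x : uniq s -> (forall b, b \in s -> B b) ->
  n2 (x - partial_exp s x) = n2 x - \sum_(b <- s) coef2 x b.
Proof.
move=> us sB; rewrite n2B n2_partial //.
suff -> : rdot x (partial_exp s x) = \sum_(b <- s) coef2 x b by ring.
rewrite -n2_partial // /n2 /rdot.
congr complex.Re; apply/eqP; rewrite -subr_eq0 -hdotBl.
rewrite [X in hdot _ X]/partial_exp hdot_sumr big_seq big1 // => b bs.
by rewrite hdotZr hdotBl hdot_partial // subrr mulr0.
Qed.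

Lemma bessel (s : seq V) x : uniq s -> (forall b, b \in s -> B b) ->
  \sum_(b <- s) coef2 x b <= n2 x.
Proof. by move=> us sB; rewrite -subr_ge0 -n2_residual // n2_ge0. Qed.

(** Pythagoras: the residual of the Fourier expansion is orthogonal to the span of the listed
    vectors. Duplicates are removed since the list of pairs may repeat a vector. *)
Lemma partial_exp_best (s : seq (R[i] * V)) x :
  (forall p, p \in s -> B p.2) ->
  n2 (x - partial_exp (undup (unzip2 s)) x) <= n2 (x - \sum_(p <- s) p.1 *: p.2).
Proof.
move=> sB; set t := undup _; set z := \sum_(p <- s) _.
have ut : uniq t by exact: undup_uniq.
have tB b : b \in t -> B b.
  by rewrite mem_undup => /mapP[p ps ->]; exact: sB.
rewrite -(subrKA (partial_exp t x) x (- z)) [leRHS]n2D.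
suff -> : rdot (x - partial_exp t x) (partial_exp t x - z) = 0.
  by rewrite mulr0 addr0 lerDl n2_ge0.
have h b : b \in t -> hdot (x - partial_exp t x) b = 0.
  by move=> bt; rewrite hdotBl hdot_partial // subrr.
rewrite rdotDr rdotNr /rdot hdot_comb; last first.
  by move=> p ps; apply: h; rewrite mem_undup map_f.
by rewrite {2}/partial_exp hdot_sumr big_seq big1 ?subrr // => b bt; rewrite hdotZr h // mulr0.
Qed.

End Bessel.

(** * Density of finite expansions and Parseval's identity *)

Section Parseval.
Context {V : hilbertType R} (B : set V).
Hypothesis bB : orthonormal_basis B.

(** [K] is the closed span of [B]. With [P] the projection onto it, [x - P x] is orthogonal to [B],
    hence zero by totality; arbitrary coefficients are then replaced by Fourier coefficients. *)
Lemma basis_dense (x : V) (e : R) : 0 < e -> exists s : seq V,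
  [/\ uniq s, forall b, b \in s -> B b & n2 (x - partial_exp s x) < e].
Proof.
have [oB tB] := bB.
pose K := [set x : V | forall e : R, 0 < e -> exists2 s : seq (R[i] * V),
  (forall p, p \in s -> B p.2) & n2 (x - \sum_(p <- s) p.1 *: p.2) < e].
have KB c b : B b -> K (c *: b).
  move=> Bb d d0; exists [:: (c, b)] => [p|].
    by rewrite inE => /eqP ->.
  by rewrite big_seq1 subrr n20.
have [|y z Ky Kz d d0|c y Ky d d0|u l ul Ku d d0|P bP hP] := @projection R V K.
- by move=> d d0; exists [::] => //; rewrite big_nil subr0 n20.
- have d4 : 0 < d / 4 by lra.
  have [s sB hs] := Ky _ d4; have [t tB' ht] := Kz _ d4.
  exists (s ++ t) => [p|]; first by rewrite mem_cat => /orP[/sB|/tB'].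
  by rewrite big_cat /= opprD addrACA (le_lt_trans (n2_le2 _ _)) //; lra.
- pose a := complex.Re c ^+ 2 + complex.Im c ^+ 2 + 1.
  have a0 : 0 < a by rewrite ltr_wpDl // addr_ge0 ?sqr_ge0.
  have [|s sB hs] := Ky (d / a); first by rewrite divr_gt0.
  exists [seq (c * p.1, p.2) | p <- s] => [_ /mapP[p /sB ? ->] //|].
  rewrite big_map (eq_bigr (fun p => c *: (p.1 *: p.2))).
    rewrite -scaler_sumr -scalerBr n2Z; move: hs; rewrite ltr_pdivlMr // => hs.
    by apply: le_lt_trans hs; rewrite mulrC ler_wpM2l ?n2_ge0 // /a; lra.
  by move=> p _ /=; rewrite scalerA.
- have d4 : 0 < d / 4 by lra.
  have [N /(_ N (leqnn _)) hN] := ul _ d4; have [s sB hs] := Ku N _ d4.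
  exists s => //; apply: le_lt_trans (n2_leB _ (u N) _) _.
  by move: hN; rewrite n2Bsym; lra.
move=> e0; have [KP oP] := hP x.
have Px : P x = x.
  apply/esym/subr0_eq/tB => b Bb; rewrite hdotC hdotE.
  rewrite -[X in _ +i* X]opprK -rdot_il (oP _ (KB 'i _ Bb)).
  by rewrite -[b]scale1r (oP _ (KB 1 _ Bb)) !oppr0 conjc0.
rewrite Px in KP; have [s sB hs] := KP _ e0.
exists (undup (unzip2 s)); split; first exact: undup_uniq.
  by move=> b; rewrite mem_undup => /mapP[p ps ->]; exact: sB.
exact: le_lt_trans (partial_exp_best oB x sB) hs.
Qed.

Local Open Scope ereal_scope.

Lemma fsets_seq (A : set V) : fsets B A ->
  exists s : seq V, [/\ uniq s, forall b, b \in s -> B b & A = [set` s]].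
Proof.
move=> [finA AB]; exists (finmap.enum_fset (fset_set A)); split; first exact: finmap.fset_uniq.
  by move=> b; rewrite in_fset_set // inE => /AB.
by apply/seteqP; split => b /=; rewrite in_fset_set // inE.
Qed.

Lemma parseval (x : V) : \esum_(b in B) (coef2 x b)%:E = (n2 x)%:E.
Proof.
apply/eqP; rewrite eq_le; apply/andP; split.
  apply: ge_ereal_sup => _ [A /fsets_seq[s [us sB ->]] <-].
  by rewrite -fsbig_seq // sumEFin lee_fin; exact: (bessel bB.1).
apply/lee_addgt0Pr => e e0.
have [s [us sB hs]] := basis_dense x e0.
move: hs; rewrite (n2_residual bB.1) // => hs.
apply: (@le_trans _ _ ((\sum_(b <- s) coef2 x b)%:E + e%:E)).
  by rewrite -EFinD lee_fin; lra.
rewrite leeD2r //; apply: esum_ge; exists [set` s].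
  by split => //; exact: finite_seq.
by rewrite -fsbig_seq // sumEFin.
Qed.

End Parseval.

Local Open Scope ereal_scope.

Lemma esum_exchange (T T' : choiceType) (I : set T) (J : set T')
    (a : T -> T' -> \bar R) : (forall i j, I i -> J j -> 0 <= a i j) ->
  \esum_(i in I) \esum_(j in J) a i j = \esum_(j in J) \esum_(i in I) a i j.
Proof.
move=> a0; rewrite !(@esum_esum R _ _ _ (fun=> _)) //; last by move=> *; exact: a0.
rewrite (reindex_esum (J `*` I) _ (fun x => (x.2, x.1)))//; split=> //=.
- by move=> [i j] [/=].
- by move=> [i1 i2] [j1 j2] /= _ _ [] -> ->.
- by move=> [i1 i2] [Pi1 Qi2] /=; exists (i2, i1).
Qed.

(** Both sides are the double sum of [|<C b, b'>|^2], read by rows or by columns. Basis independence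
    and cyclicity of the trace derive from this. *)
Lemma hs_adjoint V W (B : set V) (B' : set W) (C : V -> W) (C' : W -> V) :
  orthonormal_basis B -> orthonormal_basis B' -> linear C' ->
  (forall x y, rdot (C x) y = rdot x (C' y)) ->
  \esum_(b in B) (n2 (C b))%:E = \esum_(b in B') (n2 (C' b))%:E.
Proof.
move=> bB bB' lC' CC'.
rewrite (eq_esum (b := fun b => \esum_(b' in B') (coef2 (C b) b')%:E)); last first.
  by move=> b _; rewrite (parseval bB').
rewrite esum_exchange; last by move=> *; rewrite lee_fin coef2_ge0.
apply: eq_esum => b' _; rewrite -(parseval bB); apply: eq_esum => b _.
by rewrite (coef2_adj _ _ lC' CC') coef2C.
Qed.

Lemma pos_sqrt V (A : V -> V) : pos A ->
  exists2 C : V -> V, pos C & forall x, C (C x) = A x.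
Proof. by move=> /sqrt_exists[C pC [CC _]]; exists C. Qed.

Lemma traceE V (A : V -> V) :
  trace A = \esum_(e in hbasis V) (rdot (A e) e)%:E.
Proof. by []. Qed.

(** This is [tr (C C') = tr (C' C)] for mutually adjoint factors, the second trace being taken in an
    arbitrary basis. *)
Lemma trace_square V (A : V -> V) (B : set V) (C C' : V -> V) :
  orthonormal_basis B -> linear C' ->
  (forall x y, rdot (C x) y = rdot x (C' y)) ->
  (forall x, A x = C (C' x)) ->
  trace A = \esum_(b in B) (n2 (C b))%:E.
Proof.
move=> bB lC' CC' AE; rewrite traceE (hs_adjoint bB (hbasisP V) lC' CC').
by apply: eq_esum => e _; rewrite AE CC'.
Qed.

Lemma trace_basis V (A : V -> V) (B : set V) : pos A -> orthonormal_basis B ->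
  trace A = \esum_(e in B) (rdot (A e) e)%:E.
Proof.
move=> pA bB; have [C pC CC] := pos_sqrt pA.
rewrite (@trace_square _ _ B C C) //; first last.
- exact: pos_selfadj.
- exact: pos_lin.
by apply: eq_esum => e _; rewrite -CC (pos_selfadj pC).
Qed.

Lemma trace_ge0 V (A : V -> V) : pos A -> 0 <= trace A.
Proof. by move=> pA; apply: esum_ge0 => e _; rewrite lee_fin pos_rdot. Qed.

Lemma trace_add V (A B : V -> V) : pos A -> pos B ->
  trace (A \+ B)%R = trace A + trace B.
Proof.
move=> pA pB; rewrite !traceE -esumD; try by move=> e _; rewrite lee_fin pos_rdot.
by apply: eq_esum => e _; rewrite rdotDl EFinD.
Qed.

End OrthonormalBases.

(** * The trace norm of self-adjoint operators *)

Section TraceNorm.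
Context {R : realType}.
Implicit Type V W : hilbertType R.
Local Open Scope complex_scope.

Lemma hdot_adj V W (A : V -> W) (B : W -> V) : linear B ->
  (forall x y, rdot (A x) y = rdot x (B y)) ->
  forall x y, hdot (A x) y = hdot x (B y).
Proof. by move=> lB AB x y; rewrite !hdotE !AB (linZ lB). Qed.

Lemma adjointE V (A B : V -> V) : bop B ->
  (forall x y, rdot (A x) y = rdot x (B y)) -> adjoint A = B.
Proof.
move=> bB AB; apply: xget_unique.
  split; first exact/bounded_opP.
  exact: hdot_adj (bop_linear bB) AB.
move=> B' [_ AB']; apply/funext => y; apply: rdot_inj => x.
by rewrite rdotC /rdot -AB' -/(rdot _ _) AB rdotC.
Qed.

Lemma sqrt_opP V (A : V -> V) : pos A ->
  pos (sqrt_op A) /\ forall x, sqrt_op A (sqrt_op A x) = A x.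
Proof.
move=> pA; have [C pC CC] := pos_sqrt pA.
have [/pos_opP ? h] : [set B | pos_op B /\ B \o B = A] (sqrt_op A).
  apply: xgetPex; exists C; split; first exact/pos_opP.
  exact/funext.
by split=> // x; rewrite -[in RHS]h.
Qed.

(** [X] and [Y] are [(P + A) / 2] and [(P - A) / 2] with [P = |A|]. Since [P] commutes with [A] and
    [P ^ 2 = A ^ 2], one has [Y X = 0]; hence [Pi X = X] and [Pi Y = 0], so [S] fixes the values of
    [X] and negates those of [Y]. *)
Lemma jordan V (A : V -> V) : bop A -> selfadj A ->
  exists S X Y : V -> V,
    [/\ bop S, selfadj S & forall x, n2 (S x) = n2 x] /\
    [/\ pos X, pos Y, forall x, A x = X x - Y x,
      forall x, sqrt_op (adjoint A \o A) x = X x + Y x &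
      forall x, sqrt_op (adjoint A \o A) x = S (A x)].
Proof.
move=> bA sA; rewrite (adjointE bA sA).
have pAA := pos_square bA sA; have lA := bop_linear bA.
have [pP PP] := sqrt_opP pAA; set P := sqrt_op _ in pP PP *.
have [Q pQ [QQ QT]] := sqrt_exists pAA.
(* [P] is only known as a chosen positive root; uniqueness identifies it with the constructed root
   [Q], which commutes with [A]. *)
have PA x : P (A x) = A (P x).
  by rewrite (sqrt_uniq pQ QQ QT pP PP) QT.
have [[lP bP] sP] := (pos_lin pP, pos_bop pP, pos_selfadj pP).
pose X x := (2^-1)%:C *: (P x + A x); pose Y x := (2^-1)%:C *: (P x - A x).
have bX : bop X by apply: bop_scale; exact: bop_add.
have bY : bop Y by apply: bop_scale; exact: bop_sub.
have [lX lY] := (bop_linear bX, bop_linear bY).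
have sX : selfadj X by move=> x y; rewrite rdotZl rdotZr rdotDl rdotDr sP sA.
have sY : selfadj Y.
  by move=> x y; rewrite rdotZl rdotZr rdotDl rdotDr rdotNl rdotNr sP sA.
have half (x : V) : (2^-1)%:C *: x + (2^-1)%:C *: x = x.
  by rewrite -scalerDl -rmorphD (_ : 2^-1 + 2^-1 = 1) ?scale1r //; lra.
have XY x : A x = X x - Y x.
  by rewrite -scalerBr opprB addrC addrA subrK scalerDr half.
have PXY x : P x = X x + Y x.
  by rewrite -scalerDr addrACA subrr addr0 scalerDr half.
have YX0 x : Y (X x) = 0.
  rewrite {1}/Y (linZ lP) (linZ lA) -scalerBr (linD lP) (linD lA) PP PA.
  by rewrite /= [A (P x) + _]addrC subrr !scaler0.
have [|x y /= Kx Ky|c x /= Kx|u l ul Ku|Pi bPi hPi] := @projection R V [set x | Y x = 0].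
- exact: lin0.
- by rewrite /= (linD lY) Kx Ky addr0.
- by rewrite (linZ lY) Kx scaler0.
- apply: lim_seq_uniq (lim_seq_bop bY ul) _.
  exact: eq_lim_seq (fun n => esym (Ku n)) (lim_seq_cst 0).
have YPi x : Y (Pi x) = 0 by case: (hPi x).
have oPi k x : Y k = 0 -> rdot k (x - Pi x) = 0 by move=> Yk; exact: (hPi x).2.
have lPi := bop_linear bPi.
have PiPi x y : rdot (Pi x) y = rdot (Pi x) (Pi y).
  by apply/subr0_eq; rewrite -rdotNr -rdotDr oPi.
have sPi : selfadj Pi by move=> x y; rewrite PiPi rdotC -PiPi rdotC.
have PiK k : Y k = 0 -> Pi k = k.
  move=> Yk; apply/esym/subr0_eq/n2_eq0.
  by rewrite /n2 oPi // (linB lY) Yk YPi subrr.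
have PiX x : Pi (X x) = X x by rewrite PiK.
have PiY x : Pi (Y x) = 0.
  by apply: n2_eq0; rewrite /n2 -PiPi -sY YPi rdot0l.
have XPi x : X (Pi x) = X x.
  by apply: rdot_inj => y; rewrite sX sPi PiX sX.
exists (fun x => Pi x + Pi x - x), X, Y; split; split.
- by apply: bop_sub; [exact: bop_add|exact: bop_id].
- by move=> x y; rewrite rdotDl rdotDr rdotNl rdotNr rdotDl rdotDr sPi.
- move=> x; rewrite n2B n2D rdotDl -/(n2 _) (PiPi x x) -/(n2 _); ring.
(* On the kernel of [Y] the operator [P] agrees with [X], and on its orthogonal complement with [Y];
   both parts inherit positivity from [P] in this way. *)
- split=> // x; have := pos_rdot pP (Pi x).
  by rewrite PXY YPi addr0 XPi -sPi PiX.
- split=> // x; have := pos_rdot pP (x - Pi x).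
  rewrite PXY (linB lX) XPi subrr add0r (linB lY) YPi subr0 rdotDr rdotNr.
  by rewrite [rdot (Y x) (Pi x)]sY YPi rdot0r subr0.
- exact: XY.
- exact: PXY.
- by move=> x; rewrite PXY XY (linB lPi) PiX PiY subr0 opprB addrACA subrr addr0.
Qed.

Local Open Scope ereal_scope.

Lemma trnorm_decomp V (A : V -> V) : bop A -> selfadj A ->
  exists X Y : V -> V, [/\ pos X, pos Y, forall x, A x = (X x - Y x)%R &
    trnorm A = trace X + trace Y].
Proof.
move=> bA sA; have [S [X [Y [_ [pX pY AXY PXY _]]]]] := jordan bA sA.
exists X, Y; split=> //; rewrite -trace_add //; congr trace.
by apply/funext => x; rewrite PXY.
Qed.

(** Here [S] acts before [C], where preserving norms gives nothing directly; passing to the adjoint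
    [S \o C] moves it outside. *)
Lemma trace_dom V (X S : V -> V) C : pos X -> pos C ->
  bop S -> selfadj S -> (forall x, n2 (S x) = n2 x) -> (forall x, C (C x) = X x) ->
  \esum_(e in hbasis V) (n2 (C (S e)))%:E <= trace X.
Proof.
move=> pX pC bS sS nS CC.
rewrite (@hs_adjoint _ V V _ (hbasis V) (C \o S) (S \o C)) //=.
- rewrite traceE; apply: le_esum => e _; rewrite lee_fin nS -CC.
  by rewrite (pos_selfadj pC).
- exact: hbasisP.
- exact: hbasisP.
- by apply: bop_linear; apply: bop_comp => //; exact: pos_bop.
- by move=> x y; rewrite (pos_selfadj pC) sS.
Qed.

Lemma trnorm_le V (A X Y : V -> V) : bop A -> selfadj A -> pos X -> pos Y ->
  (forall x, A x = (X x - Y x)%R) -> trnorm A <= trace X + trace Y.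
Proof.
move=> bA sA pX pY AXY.
have [S [X' [Y' [[bS sS nS] [pX' pY' AXY' PXY PSA]]]]] := jordan bA sA.
have [C pC CC] := pos_sqrt pX; have [D pD DD] := pos_sqrt pY.
have P0 e : (0 <= rdot (sqrt_op (adjoint A \o A) e) e)%R.
  by rewrite PXY rdotDl addr_ge0 // pos_rdot.
(* By [|A| = S A], each [rdot (|A| e) e] equals [rdot (C e) (C (S e)) - rdot (D e) (D (S e))], and
   [rdot_le] bounds twice that. Both sides stay doubled to avoid dividing extended reals. *)
have h : trnorm A + trnorm A <= (trace X + trace X) + (trace Y + trace Y).
  rewrite /trnorm traceE -esumD; try by move=> e _; rewrite lee_fin.
  apply: (@le_trans _ _ (\esum_(e in hbasis V) (((rdot (X e) e)%:E +
     (n2 (C (S e)))%:E) + ((rdot (Y e) e)%:E + (n2 (D (S e)))%:E)))).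
    apply: le_esum => e _; rewrite -!EFinD lee_fin PSA sS AXY rdotDl rdotNl.
    rewrite -CC -DD !(pos_selfadj pC (C e)) !(pos_selfadj pD (D e)).
    have := rdot_le (C e) (C (S e)); have := rdot_le (D e) (- D (S e))%R.
    by rewrite n2N rdotNr /n2; lra.
  rewrite esumD; try by move=> e _; rewrite adde_ge0 // lee_fin ?n2_ge0 ?pos_rdot.
  rewrite !esumD; try by move=> e _; rewrite lee_fin ?n2_ge0 ?pos_rdot.
  by apply: leeD; apply: leeD => //; exact: trace_dom.
have := trace_ge0 pX; have := trace_ge0 pY.
have : 0 <= trnorm A by apply: esum_ge0 => e _; rewrite lee_fin; exact: P0.
move: h; case: (trnorm A) (trace X) (trace Y) => [a| |] [x| |] [y| |] //=; rewrite ?addye ?addey ?leey //.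
by rewrite -!EFinD !lee_fin; lra.
Qed.

Lemma trnorm_ge0 V (A : V -> V) : bop A -> selfadj A -> 0 <= trnorm A.
Proof.
move=> bA sA; have [X [Y [pX pY _ ->]]] := trnorm_decomp bA sA.
by rewrite adde_ge0 // trace_ge0.
Qed.

Lemma trnormD V (A B : V -> V) : bop A -> selfadj A -> bop B -> selfadj B ->
  trnorm (A \+ B)%R <= trnorm A + trnorm B.
Proof.
move=> bA sA bB sB.
have [X [Y [pX pY AXY ->]]] := trnorm_decomp bA sA.
have [X' [Y' [pX' pY' BXY ->]]] := trnorm_decomp bB sB.
rewrite addeACA -(trace_add pX pX') -(trace_add pY pY'); apply: trnorm_le.
- exact: bop_add.
- by move=> x y /=; rewrite rdotDl rdotDr sA sB.
- exact: pos_add.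
- exact: pos_add.
- by move=> x /=; rewrite AXY BXY opprD addrACA.
Qed.

Lemma trace_isometry V (A U U' : V -> V) : pos A -> bop U -> bop U' ->
  (forall x y, rdot (U x) y = rdot x (U' y)) -> (forall x, n2 (U x) = n2 x) ->
  trace (U \o A \o U') = trace A.
Proof.
move=> pA bU bU' UU' nU; have [C pC CC] := pos_sqrt pA.
rewrite (@trace_square _ V _ _ (U \o C) (C \o U') (hbasisP V)).
- rewrite traceE; apply: eq_esum => e _ /=; rewrite nU -CC.
  by rewrite (pos_selfadj pC).
- by apply: bop_linear; apply: bop_comp => //; exact: pos_bop.
- by move=> x y /=; rewrite UU' (pos_selfadj pC).
- by move=> x /=; rewrite CC.
Qed.

(** [U'] is a contraction, being the adjoint of an isometry; equality can fail when [U] is not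
    onto. *)
Lemma trace_coisometry V (A U U' : V -> V) : pos A -> bop U -> bop U' ->
  (forall x y, rdot (U x) y = rdot x (U' y)) -> (forall x, n2 (U x) = n2 x) ->
  trace (U' \o A \o U) <= trace A.
Proof.
move=> pA bU bU' UU' nU; have [C pC CC] := pos_sqrt pA.
rewrite (@trace_square _ V _ _ (U' \o C) (C \o U) (hbasisP V)).
- rewrite traceE; apply: le_esum => e _ /=; rewrite lee_fin -CC (pos_selfadj pC).
  rewrite -/(n2 _); set y := C e.
  have := rdot_le (U (U' y)) y; rewrite UU' nU -/(n2 _); lra.
- by apply: bop_linear; apply: bop_comp => //; exact: pos_bop.
- by move=> x y /=; rewrite rdotC -UU' rdotC (pos_selfadj pC).
- by move=> x /=; rewrite CC.
Qed.

(** Conjugation by [U] carries decompositions of [A] to decompositions of [U \o A \o U'], and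
    conjugation by [U'] carries them back because [U' U = 1]; each inequality is then minimality of
    the trace norm. *)
Lemma trnorm_isometry V (A U U' : V -> V) : bop A -> selfadj A ->
  bop U -> bop U' ->
  (forall x y, rdot (U x) y = rdot x (U' y)) -> (forall x, n2 (U x) = n2 x) ->
  trnorm (U \o A \o U') = trnorm A.
Proof.
move=> bA sA bU bU' UU' nU.
have [lU lU'] := (bop_linear bU, bop_linear bU').
have U'U x y : rdot (U' x) y = rdot x (U y) by rewrite rdotC -UU' rdotC.
have bUAU : bop (U \o A \o U') by apply: bop_comp => //; exact: bop_comp.
have sUAU : selfadj (U \o A \o U').
  by move=> x y /=; rewrite UU' sA U'U.
apply/eqP; rewrite eq_le; apply/andP; split.
  have [X [Y [pX pY AXY ->]]] := trnorm_decomp bA sA.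
  rewrite -(trace_isometry pX bU bU' UU' nU) -(trace_isometry pY bU bU' UU' nU).
  apply: trnorm_le => //; try exact: pos_conj.
  by move=> x /=; rewrite AXY (linB lU).
have [X [Y [pX pY AXY ->]]] := trnorm_decomp bUAU sUAU.
have U'U1 x : U' (U x) = x.
  apply: rdot_inj => y; rewrite U'U.
  have := nU (x + y)%R; rewrite (linD lU) !n2D !nU; lra.
apply: (@le_trans _ _ (trace (U' \o X \o U) + trace (U' \o Y \o U))).
  apply: trnorm_le => //; try exact: pos_conj.
  by move=> x /=; rewrite -(linB lU') -AXY /= !U'U1.
by apply: leeD; exact: trace_coisometry.
Qed.

End TraceNorm.

(** * Unconditional sums *)

Section UnconditionalSums.
Context {R : realType}.
Implicit Types (I : choiceType).
Local Open Scope complex_scope.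

Definition rsum I (B : set I) (g : I -> R) (s : R) :=
  forall eps : R, 0 < eps -> exists2 F0, fsets B F0 &
    forall F, fsets B F -> F0 `<=` F -> `|s - \sum_(i \in F) g i| < eps.

Lemma fsetsU I (B F G : set I) : fsets B F -> fsets B G -> fsets B (F `|` G).
Proof.
by move=> [fF FB] [fG GB]; split; [rewrite finite_setU|rewrite subUset].
Qed.

Lemma rsum_lin I (B : set I) g g' s s' (a b : R) :
  rsum B g s -> rsum B g' s' ->
  rsum B (fun i => a * g i + b * g' i) (a * s + b * s').
Proof.
move=> gs gs' e e0; pose c := `|a| + `|b| + 1.
have c0 : 0 < c by rewrite ltr_wpDl // addr_ge0.
have ec : 0 < e / (2 * c) by rewrite divr_gt0 // mulr_gt0.
have [F BF hF] := gs _ ec; have [F' BF' hF'] := gs' _ ec.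
exists (F `|` F'); first exact: fsetsU.
move=> G BG; rewrite subUset => -[FG F'G].
have [finG _] := BG.
rewrite fsbig_split //= -!mulr_fsumr opprD addrACA -!mulrBr.
have {hF} := hF G BG FG; have {hF'} := hF' G BG F'G.
move: (s - _) (s' - _) => x y hy hx.
apply: le_lt_trans (ler_normD _ _) _; rewrite !normrM.
have ha : `|a| * `|x| <= c * (e / (2 * c)).
  by apply: ler_pM => //; [rewrite /c -addrA lerDl addr_ge0|exact: ltW].
have hb : `|b| * `|y| < c * (e / (2 * c)).
  apply: (@le_lt_trans _ _ (c * `|y|)); last by rewrite ltr_pM2l.
  by rewrite ler_wpM2r // /c addrAC lerDr addr_ge0.
have -> : e = c * (e / (2 * c)) + c * (e / (2 * c)) by field; rewrite gt_eqF.
exact: ler_ltD.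
Qed.

Lemma rsum_uniq I (B : set I) g s s' : rsum B g s -> rsum B g s' -> s = s'.
Proof.
move=> gs gs'; apply/eqP; rewrite -subr_eq0 -normr_le0.
apply/ler_addgt0Pr => e e0; rewrite add0r.
have e2 : 0 < e / 2 by lra.
have [F BF hF] := gs _ e2; have [F' BF' hF'] := gs' _ e2.
have BU := fsetsU BF BF'.
have := hF _ BU (@subsetUl _ _ _); have := hF' _ BU (@subsetUr _ _ _).
move: (\sum_(_ \in _) _) => t h1 h2.
rewrite -(subrKA t) (le_trans (ler_normD _ _)) // (distrC t); lra.
Qed.

Lemma eq_rsum I (B : set I) g g' s :
  (forall i, B i -> g i = g' i) -> rsum B g s -> rsum B g' s.
Proof.
move=> gg' gs e /gs[F BF hF]; exists F => // G BG FG.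
rewrite (_ : \sum_(i \in G) g' i = \sum_(i \in G) g i); first exact: hF.
by apply: eq_fsbigr => i; rewrite inE => /BG.2 /gg'.
Qed.

Lemma fsum_le_esum I (B F : set I) (g : I -> R) s :
  \esum_(i in B) (g i)%:E = s%:E -> fsets B F -> \sum_(i \in F) g i <= s.
Proof.
move=> gs [finF FB]; rewrite -lee_fin -gs -fsumEFin //.
by apply: ereal_sup_ubound; exists F.
Qed.

Lemma fsum_mono I (F G : set I) (g : I -> R) : finite_set G -> F `<=` G ->
  (forall i, G i -> 0 <= g i) -> \sum_(i \in F) g i <= \sum_(i \in G) g i.
Proof.
move=> finG FG g0; have finF := sub_finite_set FG finG.
rewrite -lee_fin -!fsumEFin //; apply: lee_fsum_nneg_subset => //.
  exact/subsetP.
by move=> i; rewrite !inE => /andP[_] /set_mem/g0; rewrite lee_fin.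
Qed.

Lemma rsum_esum I (B : set I) (g : I -> R) s :
  (forall i, B i -> 0 <= g i) -> \esum_(i in B) (g i)%:E = s%:E -> rsum B g s.
Proof.
move=> g0 gs e e0.
have : ((s - e)%:E < \esum_(i in B) (g i)%:E)%E by rewrite gs lte_fin; lra.
move=> /ereal_sup_gt[_ [F BF <-]]; have [finF FB] := BF.
rewrite fsumEFin // lte_fin => hF; exists F => // G BG FG.
have h := fsum_le_esum gs BG.
have [finG GB] := BG.
have : \sum_(i \in F) g i <= \sum_(i \in G) g i.
  by apply: fsum_mono => // i /GB/g0.
by rewrite ltr_norml; lra.
Qed.

Lemma esum_rsum I (B : set I) (g : I -> R) s :
  (forall i, B i -> 0 <= g i) -> rsum B g s -> \esum_(i in B) (g i)%:E = s%:E.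
Proof.
move=> g0 gs; apply/eqP; rewrite eq_le; apply/andP; split.
  apply: ge_ereal_sup => _ [F BF <-]; have [finF FB] := BF.
  rewrite fsumEFin // lee_fin; apply/ler_addgt0Pr => e e0.
  have [G BG hG] := gs _ e0.
  have BU := fsetsU BF BG; have [finU UB] := BU.
  have := hG _ BU (@subsetUr _ _ _); rewrite ltr_norml => /andP[h _].
  have : \sum_(i \in F) g i <= \sum_(i \in F `|` G) g i.
    by apply: fsum_mono => // i /UB/g0.
  by lra.
apply/lee_addgt0Pr => e e0; have [F BF hF] := gs _ e0.
have := hF _ BF (fun _ => id); rewrite ltr_norml => /andP[_ h].
apply: (@le_trans _ _ ((\sum_(i \in F) g i)%:E + e%:E)%E).
  by rewrite -EFinD lee_fin; lra.
rewrite leeD2r // -fsumEFin; last by case: BF.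
by apply: ereal_sup_ubound; exists F.
Qed.

Lemma fsum_Re_Im I (F : set I) (f : I -> R[i]) : finite_set F ->
  \sum_(i \in F) f i =
  (\sum_(i \in F) complex.Re (f i)) +i* (\sum_(i \in F) complex.Im (f i)).
Proof.
move=> finF; rewrite !fsbig_finite //; elim/big_ind3: _ => //.
  by move=> a b c a' b' c' -> ->.
by move=> i _; case: (f i).
Qed.

Lemma has_sumP I (B : set I) (f : I -> R[i]) s : has_sum B f s <->
  rsum B (fun i => complex.Re (f i)) (complex.Re s) /\
  rsum B (fun i => complex.Im (f i)) (complex.Im s).
Proof.
split=> [fs|[fR fI] e e0].
  split=> e /fs[F BF hF]; exists F => // G BG FG.
    have := hF G BG FG; rewrite fsum_Re_Im; last by case: BG.
    move=> h; rewrite -ltcR; apply: le_lt_trans h.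
    apply: le_trans (normc_ge_Re _) => /=; by case: (s).
  have := hF G BG FG; rewrite fsum_Re_Im; last by case: BG.
  move=> h; rewrite -ltcR; apply: le_lt_trans h.
  rewrite normc_def lecR -sqrtr_sqr ler_wsqrtr //; case: (s) => a b /=.
  by rewrite lerDr sqr_ge0.
have e2 : 0 < e / 2 by lra.
have [F BF hF] := fR _ e2; have [F' BF' hF'] := fI _ e2.
exists (F `|` F'); first exact: fsetsU.
move=> G BG; rewrite subUset => -[FG F'G].
rewrite fsum_Re_Im; last by case: BG.
have := hF G BG FG; have := hF' G BG F'G; case: s {fR fI hF hF'} => a b /=.
move: (\sum_(_ \in _) _) (\sum_(_ \in _) _) => x y h1 h2.
rewrite normc_def ltcR /= => {F F' BF BF' FG F'G}.
move: h1 h2; move: (a - x) (b - y) => u v hv hu.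
apply: (@le_lt_trans _ _ (`|u| + `|v|)); last by lra.
rewrite -[leRHS]ger0_norm ?addr_ge0 // -sqrtr_sqr ler_wsqrtr //.
rewrite sqrrD !real_normK ?num_real // addrAC lerDl mulrn_wge0 // mulr_ge0 //.
Qed.

Lemma has_sum_uniq I (B : set I) (f : I -> R[i]) s s' :
  has_sum B f s -> has_sum B f s' -> s = s'.
Proof.
move=> /has_sumP[fR fI] /has_sumP[fR' fI'].
have := rsum_uniq fR fR'; have := rsum_uniq fI fI'.
by case: (s) (s') => a b [c d] /= -> ->.
Qed.

Lemma has_sum_lin I (B : set I) (f g : I -> R[i]) s s' :
  has_sum B f s -> has_sum B g s' ->
  has_sum B (fun i => f i - g i) (s - s').
Proof.
move=> /has_sumP[fR fI] /has_sumP[gR gI]; apply/has_sumP.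
split.
  have := rsum_lin 1 (-1) fR gR.
  rewrite (_ : 1 * _ + _ = complex.Re (s - s')); last first.
    by case: (s) (s') => ? ? [] ? ? /=; ring.
  by apply: eq_rsum => i _; case: (f i) (g i) => ? ? [] ? ? /=; ring.
have := rsum_lin 1 (-1) fI gI.
rewrite (_ : 1 * _ + _ = complex.Im (s - s')); last first.
  by case: (s) (s') => ? ? [] ? ? /=; ring.
by apply: eq_rsum => i _; case: (f i) (g i) => ? ? [] ? ? /=; ring.
Qed.


Lemma quadratic_discriminant (a b c : R) :
  (forall t, 0 <= t ^+ 2 * a + 2 * t * b + c) -> b ^+ 2 <= a * c.
Proof.
move=> h; have [a0|a0] := eqVneq a 0.
  have [->|b0] := eqVneq b 0; first by rewrite a0 expr0n mul0r.
  (* With [a = 0] this value of [t] turns the right-hand side into [-1]. *)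
  have := h (- (c + 1) / (2 * b)); rewrite a0 mulr0 add0r.
  rewrite (_ : 2 * _ * _ = - (c + 1)); last by field.
  by lra.
have a1 : 0 <= a.
  rewrite leNgt; apply/negP => an.
  have na : 0 < - a by lra.
  pose t := (2 * `|b| + `|c| + 1) / - a + 1; have ht := h t.
  have t1 : 1 <= t.
    rewrite /t lerDr; apply: divr_ge0; last exact: ltW.
    by rewrite addr_ge0 // addr_ge0 // mulr_ge0.
  have ta : t * a = - (2 * `|b| + `|c| + 1) + a by rewrite /t; field.
  have hb := ler_norm b; have hc := ler_norm c.
  have hn : 0 <= `|c| by [].
  have : t ^+ 2 * a = t * (t * a) by rewrite expr2 mulrA.
  by rewrite ta; nra.
have ap : 0 < a by rewrite lt_def a0.
have := h (- b / a).
rewrite (_ : _ + _ + c = c - b ^+ 2 / a); last by field.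
by rewrite subr_ge0 ler_pdivrMr // mulrC.
Qed.

(* The operator whose quadratic form is the sum of the [n2 (u b x)]. *)
Lemma sum_form I (B : set I) (V Z : hilbertType R) (u : I -> V -> Z) (M : R) :
  0 <= M -> (forall b, linear (u b)) ->
  (forall x, (\esum_(b in B) (n2 (u b x))%:E <= (M * n2 x)%:E)%E) ->
  exists2 A : V -> V, pos A & forall x y,
    rsum B (fun b => rdot (u b x) (u b y)) (rdot (A x) y).
Proof.
move=> M0 lu uM.
pose Q x := fine (\esum_(b in B) (n2 (u b x))%:E)%E.
have e0 x : (0 <= \esum_(b in B) (n2 (u b x))%:E)%E.
  by apply: esum_ge0 => b _; rewrite lee_fin n2_ge0.
have EQ x : \esum_(b in B) (n2 (u b x))%:E = (Q x)%:E.
  rewrite /Q fineK // ge0_fin_numE //; apply: le_lt_trans (uM x) _.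
  exact: ltry.
have Q0 x : 0 <= Q x by rewrite -lee_fin -EQ.
have QM x : Q x <= M * n2 x by rewrite -lee_fin -EQ.
have sQ x : rsum B (fun b => n2 (u b x)) (Q x).
  by apply: rsum_esum => // b _; exact: n2_ge0.
(* The terms [rdot (u b x) (u b y)] have no sign, so their sum is defined by polarization from the
   nonnegative sums [Q]. All algebraic properties of [s] then follow from uniqueness of
   unconditional sums. *)
pose s x y := 4^-1 * Q (x + y) + (- 4^-1) * Q (x - y).
have ss x y : rsum B (fun b => rdot (u b x) (u b y)) (s x y).
  have := rsum_lin 4^-1 (- 4^-1) (sQ (x + y)) (sQ (x - y)).
  by apply: eq_rsum => b _; rewrite (linD (lu b)) (linB (lu b)) n2D n2B; field.
have sE : forall x y t, rsum B (fun b => rdot (u b x) (u b y)) t -> s x y = t.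
  by move=> x y t; exact: rsum_uniq (ss x y).
have sC x y : s x y = s y x.
  by apply: sE; apply: eq_rsum (ss y x) => b _; rewrite rdotC.
have sDl x x' y : s (x + x') y = s x y + s x' y.
  apply: sE; rewrite -[s x y]mul1r -[s x' y]mul1r.
  apply: eq_rsum (rsum_lin 1 1 (ss x y) (ss x' y)) => b _.
  by rewrite !mul1r (linD (lu b)) rdotDl.
have sZl (r : R) x y : s (r%:C *: x) y = r * s x y.
  apply: sE; rewrite -[r * s x y]addr0 -[X in _ + X](mul0r (s x y)).
  apply: eq_rsum (rsum_lin r 0 (ss x y) (ss x y)) => b _.
  by rewrite mul0r addr0 (linZ (lu b)) rdotZl.
have sxx x : s x x = Q x.
  by apply: sE; exact: sQ.
have [||||||| A bA hA] := @form_operator R V V s (M ^+ 2).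
- exact: sDl.
- by move=> x y y'; rewrite sC sDl !(sC _ x).
- exact: sZl.
- by move=> r x y; rewrite sC sZl sC.
- move=> x y; apply: sE; apply: eq_rsum (ss x y) => b _.
  by rewrite !(linZ (lu b)) rdot_ii.
- exact: sqr_ge0.
- move=> x y; apply: (@le_trans _ _ (Q x * Q y)).
    apply: quadratic_discriminant => t.
    have := Q0 (t%:C *: x + y).
    rewrite -sxx sDl sZl !(sC _ (_ + y)) !sDl !sZl !sxx (sC y x).
    by move=> h; apply: le_trans h _; rewrite le_eqVlt; apply/orP; left; apply/eqP; ring.
  have -> : M ^+ 2 * n2 x * n2 y = (M * n2 x) * (M * n2 y) by ring.
  by apply: ler_pM.
exists A => [|x y]; last by rewrite hA.
split=> // [x y|x]; first by rewrite [RHS]rdotC !hA sC.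
by rewrite hA sxx.
Qed.

End UnconditionalSums.

(** * Tensor products and partial traces *)

Section Tensor.
Context {R : realType}.
Local Open Scope complex_scope.

Lemma hdot0_rdot (V : hilbertType R) (x z : V) :
  (forall c : R[i], rdot (c *: x) z = 0) -> hdot x z = 0.
Proof.
move=> h; rewrite hdotE -[X in _ +i* X]opprK -rdot_il h oppr0.
by rewrite -[x]scale1r h.
Qed.

(* Symmetric in the two factors, unlike [hilbert_tensor], so that each
   construction on one side also serves for the other side. *)
Record is_tensor (V W Z : hilbertType R) (T : V -> W -> Z) : Prop := IsTensor {
  tens_linl : forall y, linear (T^~ y);
  tens_linr : forall x, linear (T x);
  hdot_tens : forall x x' y y', hdot (T x y) (T x' y') = hdot x x' * hdot y y';
  tens_total : forall z, (forall x y, rdot (T x y) z = 0) -> z = 0 }.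

Lemma tensor_swap (V W Z : hilbertType R) (T : V -> W -> Z) :
  is_tensor T -> is_tensor (fun y x => T x y).
Proof.
case=> ll lr hd tot; split=> //.
  by move=> *; rewrite hd mulrC.
by move=> z h; apply: tot => x y; exact: h.
Qed.

(** If [z] is nonzero and orthogonal to all elementary tensors, density provides a combination [w]
    of them closer to [z] than [0] is; but [w] is orthogonal to [z], so
    [n2 (z - w) = n2 z + n2 w]. *)
Lemma hilbert_tensorP (V W Z : hilbertType R) (T : {bilinear V -> W -> Z}) :
  hilbert_tensor T -> is_tensor T.
Proof.
move=> [hd dn]; split=> //.
- by move=> y c x x'; rewrite linearPl.
- by move=> x c y y'; rewrite linearPr.
move=> z h; apply: contrapT => /eqP z0.
have nz : 0 < `|z| by rewrite normr_gt0.
have [||w [zw [n [x [y wE]]]]] := dn ((ball z `|z|)^°).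
- exists z; exact: nbhsx_ballx.
- exact: open_interior.
have := interior_subset zw; rewrite -ball_normE /= !normE ltcR.
have nz2 : 0 < n2 z.
  rewrite lt_def n2_ge0 andbT; apply/eqP => /n2_eq0 zE.
  by move: z0; rewrite zE eqxx.
rewrite ltr_sqrt // n2B.
have -> : rdot z w = 0.
  rewrite rdotC wE /rdot hdot_suml big1 // => i _.
  apply: hdot0_rdot => c; by rewrite -[c *: _]linearZl_LR h.
by have := n2_ge0 w; lra.
Qed.

Section OneTensor.
Context {V W Z : hilbertType R} (T : V -> W -> Z).
Hypothesis tT : is_tensor T.

Lemma n2_tens x y : n2 (T x y) = n2 x * n2 y.
Proof.
by apply: complexI; rewrite -hdotxx (hdot_tens tT) !hdotxx [RHS]rmorphM.
Qed.

Lemma bop_tensr x : bop (T x).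
Proof.
split; first exact: tens_linr tT x.
by exists (n2 x) => [|y]; [exact: n2_ge0|rewrite n2_tens].
Qed.

Lemma bop_tensl y : bop (T^~ y).
Proof.
split; first exact: tens_linl tT y.
by exists (n2 y) => [|x]; [exact: n2_ge0|rewrite n2_tens mulrC].
Qed.

(** Totality speaks of orthogonality, so equality is tested on the adjoints: [A' u - B' u] is
    orthogonal to every elementary tensor. *)
Lemma bop_tensor_ext (U : hilbertType R) (A B : Z -> U) : bop A -> bop B ->
  (forall x y, A (T x y) = B (T x y)) -> A = B.
Proof.
move=> bA bB AB.
have [A' bA' AA'] := adjoint_exists bA; have [B' bB' BB'] := adjoint_exists bB.
apply/funext => z; apply: rdot_inj => u; rewrite AA' BB'.
suff -> : A' u = B' u by [].
apply/subr0_eq/(tens_total tT) => x y.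
by rewrite rdotDr rdotNr -AA' -BB' AB subrr.
Qed.

Definition prod_set (B : set V) (B' : set W) : set Z :=
  [set T p.1 p.2 | p in B `*` B'].

Lemma prod_basis (B : set V) (B' : set W) :
  orthonormal_basis B -> orthonormal_basis B' ->
  set_inj (B `*` B') (fun p => T p.1 p.2) /\ orthonormal_basis (prod_set B B').
Proof.
move=> [oB tB] [oB' tB'].
have inj : set_inj (B `*` B') (fun p => T p.1 p.2).
  move=> [e f] [e' f'] /set_mem[/= Be Bf] /set_mem[/= Be' Bf'] TE.
  have := hdot_tens tT e e' f f'; rewrite TE (hdot_tens tT) !oB ?oB' //= !eqxx mulr1.
  case: eqP => [->|_]; last by rewrite mul0r => /eqP; rewrite oner_eq0.
  case: eqP => [->|_] //; by rewrite mulr0 => /eqP; rewrite oner_eq0.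
split=> //; split.
  move=> _ _ [[e f] [/= Be Bf] <-] [[e' f'] [/= Be' Bf'] <-] /=.
  rewrite (hdot_tens tT) oB // oB' // -natrM mulnb.
  congr (_%:R); congr nat_of_bool; apply/idP/idP => [/andP[/eqP -> /eqP ->] //|].
  move=> /eqP TE; have := inj (e, f) (e', f').
  by rewrite !inE => /(_ (conj Be Bf) (conj Be' Bf') TE)[-> ->]; rewrite !eqxx.
move=> z h.
have h1 f x : B' f -> rdot (T x f) z = 0.
  move=> Bf; have [S bS TS] := adjoint_exists (bop_tensl f).
  rewrite TS; suff -> : S z = 0 by rewrite rdot0r.
  apply: tB => e Be; rewrite hdotC hdot0_rdot ?conjc0 // => c.
  rewrite -TS (linZ (tens_linl tT f)) /rdot hdotZl hdotC h ?conjc0 ?mulr0 //.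
  by exists (e, f).
apply: (tens_total tT) => x y.
have [S bS TS] := adjoint_exists (bop_tensr x).
rewrite TS; suff -> : S z = 0 by rewrite rdot0r.
apply: tB' => f Bf; rewrite hdotC hdot0_rdot ?conjc0 // => c.
by rewrite -TS (linZ (tens_linr tT x)) -(linZ (tens_linl tT f)) h1.
Qed.

Local Open Scope ereal_scope.

Lemma esum_prod (B : set V) (B' : set W) (g : Z -> \bar R) :
  orthonormal_basis B -> orthonormal_basis B' -> (forall z, 0 <= g z) ->
  \esum_(z in prod_set B B') g z = \esum_(e in B) \esum_(f in B') g (T e f).
Proof.
move=> bB bB' g0; have [inj _] := prod_basis bB bB'.
by rewrite (@esum_esum R _ _ B (fun=> B')) // -(esum_image _ _ g inj).
Qed.

Lemma trace_prod (A : Z -> Z) (B : set V) (B' : set W) :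
  pos A -> orthonormal_basis B -> orthonormal_basis B' ->
  trace A = \esum_(e in B) \esum_(f in B') (rdot (A (T e f)) (T e f))%:E.
Proof.
move=> pA bB bB'; have [_ bT] := prod_basis bB bB'.
rewrite (trace_basis pA bT) (esum_prod bB bB' (g := fun z => (rdot (A z) z)%:E)) //.
by move=> z; rewrite lee_fin pos_rdot.
Qed.

(** [S f] contracts the second factor with [f]. Summing over [f] exhibits the tensor product as an
    orthogonal sum of copies of [V], which bounds the forms used in [left_op] and
    [partial_trace_exists]. *)
Lemma slice_parseval (B' : set W) (S : W -> Z -> V) (z : Z) :
  orthonormal_basis B' -> (forall y x z, rdot (T x y) z = rdot x (S y z)) ->
  \esum_(f in B') (n2 (S f z))%:E = (n2 z)%:E.
Proof.
move=> bB' TS; have bB := hbasisP V; have [_ bT] := prod_basis bB bB'.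
rewrite -(parseval bT z) (esum_prod bB bB' (g := fun b => (coef2 z b)%:E)); last first.
  by move=> b; rewrite lee_fin coef2_ge0.
rewrite esum_exchange; last by move=> *; rewrite lee_fin coef2_ge0.
apply: eq_esum => f _; rewrite -(parseval bB); apply: eq_esum => e _.
congr (_%:E); apply: (@coef2_adj _ Z V (S f) (T^~ f)); first exact: tens_linl tT f.
by move=> z' x; rewrite rdotC -TS rdotC.
Qed.

Lemma slices_exist : exists2 S : W -> Z -> V, forall y, bop (S y) &
  forall y x z, rdot (T x y) z = rdot x (S y z).
Proof.
have /choice[S hS] : forall y, exists S : Z -> V,
    bop S /\ forall x z, rdot (T x y) z = rdot x (S z).
  by move=> y; have [S bS TS] := adjoint_exists (bop_tensl y); exists S.
by exists S => y; case: (hS y).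
Qed.

Lemma esum_leZ (I : choiceType) (B : set I) (g : I -> R) (c s : R) :
  (0 <= c)%R -> \esum_(i in B) (g i)%:E <= s%:E ->
  \esum_(i in B) (c * g i)%:E <= (c * s)%:E.
Proof.
move=> c0 gs; apply: ge_ereal_sup => _ [F BF <-]; have [finF _] := BF.
rewrite fsumEFin // -mulr_fsumr lee_fin ler_wpM2l // -lee_fin -fsumEFin //.
by apply: le_trans gs; apply: ereal_sup_ubound; exists F.
Qed.

(** The form of [A (x) 1] is the sum over [f] of [rdot (A (S f z)) (S f w)]; writing [A] as [C ^ 2]
    gives it the shape required by [sum_form]. *)
Lemma left_op (A : V -> V) : pos A ->
  exists2 L : Z -> Z, pos L & forall x y, L (T x y) = T (A x) y.
Proof.
move=> pA; have [C pC CC] := pos_sqrt pA.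
have [S bS TS] := slices_exist.
have [lC [M M0 hM]] := pos_bop pC.
have bB' := hbasisP W.
have [||L pL hL] := @sum_form R W (hbasis W) Z V (fun f z => C (S f z)) M M0.
- by move=> f; apply: bop_linear (bop_comp (pos_bop pC) (bS f)).
- move=> z; apply: (@le_trans _ _ (\esum_(f in hbasis W) (M * n2 (S f z))%:E)).
    by apply: le_esum => f _; rewrite lee_fin.
  by apply: esum_leZ => //; rewrite (slice_parseval _ bB').
exists L => // x y; apply: rdot_inj => w.
apply: rsum_uniq (hL (T x y) w) _.
have n2S z : rsum (hbasis W) (fun f => n2 (S f z)) (n2 z).
  by apply: rsum_esum => [f _|]; rewrite ?n2_ge0 // (slice_parseval _ bB').
(* Polarizing [slice_parseval] writes [rdot (T (A x) y) w] as a sum over [f], which matches the form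
   of [L] term by term because [S f (T u y) = <y, f> u]. *)
have := rsum_lin 4^-1 (- 4^-1) (n2S (T (A x) y + w)%R) (n2S (T (A x) y - w)%R).
rewrite (_ : (_ * _ + _)%R = rdot (T (A x) y) w); last by rewrite n2D n2B; field.
apply: eq_rsum => f _.
have lS := bop_linear (bS f).
have ST u : S f (T u y) = hdot y f *: u.
  apply: rdot_inj => v; rewrite rdotC -TS [RHS]rdotC /rdot (hdot_tens tT).
  by rewrite hdotZr (hdotC f y) mulrC.
rewrite -(pos_selfadj pC) CC (linD lS) (linB lS) n2D n2B !ST.
by rewrite -(linZ (pos_lin pA)); field.
Qed.

(** With [C] the root of [rho], [n2 (C (T x e))] is the sum over [b] of [|<x, S e (C b)>|^2], each
    term at most [n2 x * n2 (S e (C b))]. Summing over [e] by [slice_parseval] and then over [b]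
    bounds the form by [n2 x] times the trace. *)
Lemma partial_trace_exists (rho : Z -> Z) : pos rho -> trace rho < +oo ->
  exists2 A : V -> V, pos A & trace A = trace rho /\ forall x x',
    has_sum (hbasis W) (fun e => hdot (rho (T x e)) (T x' e)) (hdot (A x) x').
Proof.
move=> prho trfin; have [C pC CC] := pos_sqrt prho.
have [S bS TS] := slices_exist.
have [bB bB' bZ] := And3 (hbasisP V) (hbasisP W) (hbasisP Z).
have lC := pos_lin pC; have sC := pos_selfadj pC.
have tr0 := trace_ge0 prho.
have trE : trace rho = (fine (trace rho))%:E by rewrite fineK // ge0_fin_numE.
have trC : trace rho = \esum_(b in hbasis Z) (n2 (C b))%:E.
  by rewrite traceE; apply: eq_esum => b _; rewrite -CC sC.
have [||A pA hA] := @sum_form R W (hbasis W) V Z (fun e x => C (T x e))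
    (fine (trace rho)) (fine_ge0 tr0).
- by move=> e; apply: bop_linear (bop_comp (pos_bop pC) (bop_tensl e)).
- move=> x.
  rewrite (eq_esum (b := fun e => \esum_(b in hbasis Z) (coef2 (T x e) (C b))%:E)); last first.
    move=> e _; rewrite -(parseval bZ); apply: eq_esum => b _.
    by rewrite (coef2_adj _ _ lC sC).
  rewrite esum_exchange; last by move=> *; rewrite lee_fin coef2_ge0.
  rewrite mulrC; apply: (@le_trans _ _ (\esum_(b in hbasis Z) (n2 x * n2 (C b))%:E)).
    apply: le_esum => b _.
    rewrite -[X in _ <= X]/((n2 x * n2 (C b))%:E).
    apply: (@le_trans _ _ (\esum_(e in hbasis W) (n2 x * n2 (S e (C b)))%:E)).
      apply: le_esum => e _; rewrite lee_fin.
      rewrite (@coef2_adj _ V Z (T^~ e) (S e)); last by move=> *; exact: TS.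
        exact: coef2_le.
      exact: bop_linear.
    by apply: esum_leZ; rewrite ?n2_ge0 // (slice_parseval _ bB').
  by apply: esum_leZ; rewrite ?n2_ge0 // -trC -trE.
exists A => //; split.
  rewrite (trace_prod prho bB bB') traceE; apply: eq_esum => e _.
  rewrite -(@esum_rsum _ _ (hbasis W) (fun f => rdot (C (T e f)) (C (T e f)))).
  - by apply: eq_esum => f _; rewrite -sC CC.
  - by move=> f _; exact: n2_ge0.
  - exact: hA.
move=> x x'; apply/has_sumP; rewrite !hdotE /=; split.
  by apply: eq_rsum (hA x x') => e _; rewrite hdotE /= -sC CC.
apply: eq_rsum (hA x ('i *: x')%R) => e _.
by rewrite hdotE /= -sC CC (linZ (tens_linl tT e)).
Qed.

End OneTensor.

(** [A (x) B] is the square of [(sqrt A (x) 1) (1 (x) sqrt B)], whose self-adjoint factors commute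
    on elementary tensors, hence everywhere; positivity is then immediate. *)
Lemma tensor_pos (V W Z : hilbertType R) (T : V -> W -> Z) A B :
  is_tensor T -> pos A -> pos B ->
  exists2 K : Z -> Z, pos K & forall x y, K (T x y) = T (A x) (B y).
Proof.
move=> tT pA pB; have [C pC CC] := pos_sqrt pA; have [D pD DD] := pos_sqrt pB.
have [L pL hL] := left_op tT pC; have [M pM hM] := left_op (tensor_swap tT) pD.
have bLM := bop_comp (pos_bop pL) (pos_bop pM).
have LM : L \o M = M \o L.
  apply: (bop_tensor_ext tT bLM (bop_comp (pos_bop pM) (pos_bop pL))) => x y /=.
  by rewrite hM !hL hM.
exists ((L \o M) \o (L \o M)).
  apply: pos_square => // z w.
  by rewrite {1}LM /= (pos_selfadj pM) (pos_selfadj pL).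
by move=> x y /=; rewrite hM hL hM hL CC DD.
Qed.

Local Open Scope ereal_scope.

Lemma pos_hdot (V : hilbertType R) (A : V -> V) x : pos A ->
  hdot (A x) x = (rdot (A x) x)%:C.
Proof.
move=> /pos_opP[_ /(_ x)]; rewrite lecE => /andP[/eqP h _].
by rewrite hdotE -Im_hdot h.
Qed.

Lemma trace_tensor_le (V W Z : hilbertType R) (T : V -> W -> Z) A B K :
  is_tensor T -> pos A -> pos B -> pos K ->
  (forall x y, K (T x y) = T (A x) (B y)) -> trace B = 1 ->
  trace K <= trace A.
Proof.
move=> tT pA pB pK hK trB.
rewrite (trace_prod tT pK (hbasisP V) (hbasisP W)) [leRHS]traceE.
apply: le_esum => e _.
rewrite (eq_esum (b := fun f => (rdot (A e) e * rdot (B f) f)%:E)); last first.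
  move=> f _; rewrite hK /rdot (hdot_tens tT) !pos_hdot // -rmorphM //.
by rewrite -[X in _ <= X%:E]mulr1; apply: esum_leZ; rewrite ?pos_rdot // -traceE trB.
Qed.

End Tensor.

(** * The propagator is isometric *)

Section NumericalRadius.
Context {R : realType}.
Local Open Scope complex_scope.

(** This compares operators described by their forms. Polarization gives
    [rdot (K x) y <= eps * (n2 x + n2 y)]; taking [y] a multiple of [K x] and the discriminant in
    the multiplier produces the factor [4]. For [eps = 0], an operator with zero form vanishes. *)
Lemma numerical_radius (V : hilbertType R) (K : V -> V) (eps : R) : linear K ->
  0 <= eps -> (forall x, `|rdot (K x) x| <= eps * n2 x) ->
  (forall x, `|rdot (K x) ('i *: x)| <= eps * n2 x) ->
  forall x, n2 (K x) <= 4 * eps ^+ 2 * n2 x.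
Proof.
move=> lK e0 hR hI.
have pol x y : rdot (K x) y <= eps * (n2 x + n2 y).
  have h1 := hR (x + y); have h2 := hR (x - y).
  have h3 := hI (x - 'i *: y); have h4 := hI (x + 'i *: y).
  move: h1 h2 h3 h4; rewrite !ler_norml => /andP[_ h1] /andP[h2 _] /andP[_ h3] /andP[h4 _].
  move: h1 h2 h3 h4.
  rewrite !n2D !n2N !n2i !rdotNr.
  rewrite !scalerDr !scalerN !scaleii !(linD lK) !(linN lK) !(linZ lK).
  rewrite !(rdotDl, rdotDr, rdotNl, rdotNr, rdot_ii, rdot_il).
  by lra.
move=> x; set a := n2 (K x).
have : (- (2^-1) * a) ^+ 2 <= (eps * a) * (eps * n2 x).
  apply: quadratic_discriminant => t.
  have := pol x (t%:C *: K x); rewrite rdotZr n2Zr -/(n2 _) -/a; lra.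
have [->|a0] := eqVneq a 0; first by rewrite mulr_ge0 ?n2_ge0 // mulr_ge0 ?sqr_ge0.
have ap : 0 < a by rewrite lt_def a0 n2_ge0.
move=> h; rewrite -(ler_pM2l ap); move: h.
rewrite exprMn sqrrN (_ : 2^-1 ^+ 2 = 4^-1 :> R); last by field.
by nra.
Qed.

Lemma n2_sum_orth (V : hilbertType R) (I : finType) (v : I -> V) :
  (forall i j, i != j -> rdot (v i) (v j) = 0) ->
  n2 (\sum_i v i) = \sum_i n2 (v i).
Proof.
move=> orth; rewrite /n2 {1}/rdot hdot_suml raddf_sum; apply: eq_bigr => i _.
rewrite hdot_sumr raddf_sum (bigD1 i) //= big1 ?addr0 // => j ji.
by apply: orth; rewrite eq_sym.
Qed.

End NumericalRadius.

Section RawIntegral.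
Import HBNNSimple.

(* Unlike in [eq_measure_integral], [m1] and [m2] need not be measures. *)
Lemma eq_raw_integral (R : realType) (d : measure_display) (T : measurableType d)
    (m1 m2 : set T -> \bar R) (f : T -> \bar R) :
  (forall B, measurable B -> m1 B = m2 B) ->
  integral m1 setT f = integral m2 setT f.
Proof.
move=> m12; have sE (h : {nnsfun T >-> R}) : sintegral m1 h = sintegral m2 h.
  by apply: eq_fsbigr => r _; rewrite m12.
rewrite /integral; congr (ereal_sup _ - ereal_sup _)%E;
  by apply/seteqP; split => _ [h hf <-]; exists h.
Qed.

End RawIntegral.

(** * Integrals of functions nearly constant on the fibres of a finite-valued map *)

Section StepIntegral.
Context {d : measure_display} {T : measurableType d} {R : realType}.
Variables (mu : {measure set T -> \bar R}) (I : finType) (idx : T -> I).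
Hypotheses (mu_fin : (mu setT < +oo)%E)
  (mB : forall i, measurable (idx @^-1` [set i])).
Let B i := idx @^-1` [set i].

Lemma fibre_integrable (f : T -> R) A : measurable A ->
  measurable_fun setT f -> (exists M : R, forall l, `|f l| <= M) ->
  mu.-integrable A (EFin \o f).
Proof.
move=> mA mf [M hM]; apply: measurable_bounded_integrable => //.
- by apply: le_lt_trans mu_fin; apply: le_measure => //; rewrite inE.
- exact: measurable_funTS.
- by exists M; split; [exact: num_real|move=> x Mx l _; exact: le_trans (hM l) (ltW Mx)].
Qed.

Lemma fibre_integral (f : T -> R) :
  measurable_fun setT f -> (exists M : R, forall l, `|f l| <= M) ->
  \int[mu]_(l in setT) f l = \sum_i \int[mu]_(l in B i) f l.
Proof.
move=> mf bf.
have BT : \big[setU/set0]_(i <- enum I) B i = setT.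
  apply/seteqP; split=> // l _; rewrite -bigcup_seq.
  by exists (idx l) => //=; rewrite mem_enum.
have tB : trivIset [set` enum I] B.
  by move=> i j _ _ [l [/= <- <-]].
have := @integral_bigsetU_EFin _ _ _ mu _ B f (enum I) mB (enum_uniq _) tB.
rewrite /= BT => h0.
have h : (\int[mu]_(x in setT) (f x)%:E =
    \sum_(i <- enum I) \int[mu]_(x in B i) (f x)%:E)%E.
  by apply: h0; exact/measurable_realfun.measurable_EFinP.
apply: EFin_inj; rewrite /Rintegral fineK; last first.
  by apply: integrable_fin_num => //; exact: fibre_integrable.
rewrite h big_enum /= -sumEFin; apply: eq_bigr => i _; rewrite fineK //.
by apply: integrable_fin_num => //; [exact: mB|apply: fibre_integrable => //; exact: mB].
Qed.

Lemma step_integral (f : T -> R) (a : I -> R) (eps : R) :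
  measurable_fun setT f -> (exists M : R, forall l, `|f l| <= M) ->
  (forall l, `|f l - a (idx l)| <= eps) ->
  `|\int[mu]_(l in setT) f l - \sum_i a i * fine (mu (B i))|
    <= eps * fine (mu setT).
Proof.
move=> mf bf fa.
have cstb (r : R) : exists M : R, forall l : T, `|cst r l| <= M by exists `|r|.
have -> : fine (mu setT) = \sum_i fine (mu (B i)).
  rewrite -[LHS]mul1r -Rintegral_cst // (@fibre_integral (cst 1) _ (cstb 1)) //.
  by apply: eq_bigr => i _; rewrite Rintegral_cst ?mul1r //; exact: mB.
rewrite fibre_integral // -sumrB mulr_sumr.
apply: le_trans (ler_norm_sum _ _ _) _; apply: ler_sum => i _.
have int (g : T -> R) : measurable_fun setT g -> (exists M : R, forall l, `|g l| <= M) ->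
    mu.-integrable (B i) (EFin \o g).
  by apply: fibre_integrable; exact: mB.
have cint (r : R) : mu.-integrable (B i) (EFin \o cst r) by apply: int.
have mBi : measurable (B i) := mB i.
have h1 : (a i - eps) * fine (mu (B i)) <= \int[mu]_(l in B i) f l.
  rewrite -Rintegral_cst //; apply: le_Rintegral => //; [exact: cint|exact: int|].
  by move=> l /= <-; have := fa l; rewrite ler_norml; lra.
have h2 : \int[mu]_(l in B i) f l <= (a i + eps) * fine (mu (B i)).
  rewrite -Rintegral_cst //; apply: le_Rintegral => //; [exact: int|exact: cint|].
  by move=> l /= <-; have := fa l; rewrite ler_norml; lra.
by rewrite ler_norml; move: h1 h2; lra.
Qed.

End StepIntegral.

Section Grid.
Context {R : realType}.

(* A measurable map to a finite type separating, up to [eps], the values of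
   finitely many bounded measurable functions. *)
Lemma finite_grid (u v : R -> R) (eps : R) : 0 < eps ->
  measurable_fun setT u -> measurable_fun setT v ->
  (forall l, -1 <= u l <= 1) -> (forall l, -1 <= v l <= 1) ->
  exists (I : finType) (idx : R -> I),
    (forall i, measurable (idx @^-1` [set i])) /\
    forall l l', idx l = idx l' -> `|u l - u l'| <= eps /\ `|v l - v l'| <= eps.
Proof.
move=> e0 mu mv u1 v1.
(* The map records which levels [k * eps - 1] are reached. The level just below a value [w] in
   [[-1, 1]] has index [trunc ((w + 1) / eps) <= trunc (2 / eps)], whence the count; values reaching
   the same levels differ by at most [eps]. *)
pose n := (Num.trunc (2 / eps)).+1.
pose th (k : 'I_n) : R := k%:R * eps - 1.
exists {ffun 'I_n -> bool * bool}.
exists (fun l => [ffun k => (th k <= u l, th k <= v l)]); split.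
  move=> i; rewrite (_ : _ @^-1` _ = \bigcap_(k in [set: 'I_n])
    ((fun l => th k <= u l) @^-1` [set (i k).1] `&`
     (fun l => th k <= v l) @^-1` [set (i k).2])); last first.
    apply/seteqP; split=> l /=.
      by move=> <- k _ /=; rewrite ffunE.
    move=> h; apply/ffunP => k; rewrite ffunE; have [-> ->] := h k I.
    by case: (i k).
  apply: fin_bigcap_measurable => [|k _]; first exact: finite_finset.
  have m (w : R -> R) (b : bool) : measurable_fun setT w ->
      measurable ((fun l => th k <= w l) @^-1` [set b]).
    move=> mw; have mt : measurable (w @^-1` `[th k, +oo[).
      by rewrite -[X in measurable X]setTI; apply: mw => //; exact: measurable_itv.
    case: b.
      by rewrite (_ : _ @^-1` _ = w @^-1` `[th k, +oo[) //; apply/seteqP; split=> l /=; rewrite in_itv /= andbT.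
    rewrite (_ : _ @^-1` _ = ~` (w @^-1` `[th k, +oo[)); first exact: measurableC.
    by apply/seteqP; split=> l /=; rewrite in_itv /= andbT; [move=> ->|move=> /negP/negbTE].
  by apply: measurableI; exact: m.
have sep (w : R -> R) l l' : (forall l, -1 <= w l <= 1) ->
    (forall k : 'I_n, (th k <= w l) = (th k <= w l')) -> w l - w l' <= eps.
  move=> w1 h; have /andP[a1 a2] := w1 l.
  have p0 : 0 <= (w l + 1) / eps by apply: divr_ge0; [lra|exact: ltW].
  have /andP[k1 k2] := truncn_itv p0.
  set k := Num.trunc _ in k1 k2.
  have kn : (k < n)%N.
    rewrite ltnS; apply: le_truncn.
    by rewrite ler_pM2r ?invr_gt0 //; lra.
  have := h (Ordinal kn); rewrite /th /=.
  move: k1; rewrite ler_pdivlMr // => k1; rewrite [X in X = _](_ : _ = true); last by lra.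
  move=> /esym h'.
  move: k2; rewrite ltr_pdivrMr // -natr1 mulrDl mul1r; lra.
move=> l l' /ffunP h.
have hu k : (th k <= u l) = (th k <= u l') by have := h k; rewrite !ffunE => -[].
have hv k : (th k <= v l) = (th k <= v l') by have := h k; rewrite !ffunE => -[].
by rewrite !ler_norml; split; apply/andP; split; rewrite 1?lerNl ?opprB; apply: sep.
Qed.

End Grid.

(** * Spectral measures and functions of modulus one *)

Section SpectralMeasure.
Context {R : realType} {V : hilbertType R} (E : set R -> V -> V).
Hypothesis hE : projection_valued_measure E.
Local Open Scope complex_scope.

Lemma pvm_bop B : measurable B -> bop (E B).
Proof. by move=> mB; have [/(_ B mB)[/bounded_opP]] := hE. Qed.

Lemma pvm_idem B x : measurable B -> E B (E B x) = E B x.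
Proof. by move=> mB; have [/(_ B mB)[_ h _] _ _] := hE; rewrite -[in RHS]h. Qed.

Lemma pvm_selfadj B : measurable B -> selfadj (E B).
Proof. by move=> mB x y; have [/(_ B mB)[_ _ h] _ _] := hE; rewrite /rdot h. Qed.

Lemma pvm_rdot B x : measurable B -> rdot (E B x) x = n2 (E B x).
Proof. by move=> mB; rewrite /n2 [RHS](pvm_selfadj mB) pvm_idem // rdotC. Qed.

(** For the sequence of empty sets, consecutive partial sums differ by [E set0 x] but have the same
    limit. *)
Lemma pvm_set0 x : E set0 x = 0.
Proof.
have [_ _ /(_ (fun=> set0))] := hE.
move=> /(_ (fun=> measurable0) (@trivIset_set0 _ _ _) x) /cvg_lim_seq.
rewrite bigcup0 // => h.
have h' := lim_seq_add h (lim_seq_cst (E set0 x)).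
apply: (@addrI _ (E set0 x)); rewrite addr0.
apply: lim_seq_uniq h' _; apply: eq_lim_seq (lim_seq_shift h) => n.
by rewrite big_nat_recr.
Qed.

(** It agrees with [spectral_mu E x] on measurable sets, and [n2] makes it nonnegative on all sets,
    as the measure structure demands. Integrals are transferred by [eq_raw_integral]. *)
Definition spectral_meas (x : V) (B : set R) : \bar R := (n2 (E B x))%:E.

Lemma spectral_meas0 x : spectral_meas x set0 = 0%E.
Proof. by rewrite /spectral_meas pvm_set0 n20. Qed.

Lemma spectral_meas_ge0 x B : (0 <= spectral_meas x B)%E.
Proof. by rewrite lee_fin n2_ge0. Qed.

Lemma spectral_meas_sigma_additive x : semi_sigma_additive (spectral_meas x).
Proof.
move=> F mF tF mUF.
have [_ _ /(_ F mF tF x) /cvg_lim_seq /(@lim_seq_cvg _ _ _ _ x)] := hE.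
rewrite pvm_rdot // => h.
rewrite (_ : (fun n => _) = EFin \o (fun n => rdot (\sum_(0 <= k < n) E (F k) x) x)).
  exact: cvg_comp h _.
apply/funext => n /=; rewrite /rdot hdot_suml raddf_sum -sumEFin.
by apply: eq_bigr => i _; rewrite /spectral_meas -pvm_rdot.
Qed.

HB.instance Definition _ x := isMeasure.Build _ _ _ (spectral_meas x)
  (spectral_meas0 x) (spectral_meas_ge0 x) (@spectral_meas_sigma_additive x).

Lemma spectral_integral x (f : R -> \bar R) :
  integral (spectral_mu E x) setT f = integral (spectral_meas x) setT f.
Proof.
apply: eq_raw_integral => B mB; rewrite /spectral_mu /spectral_meas -pvm_rdot //.
Qed.

(** By additivity of the measures the difference [K] has zero quadratic form, so it vanishes by
    [numerical_radius]. Comparing norms gives [rdot (E A x) (E B x) = 0], which at [E A x] becomes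
    [E B (E A x) = 0] by idempotence. *)
Lemma pvm_disjoint A B : measurable A -> measurable B -> A `&` B = set0 ->
  forall x y, rdot (E A x) (E B y) = 0.
Proof.
move=> mA mB AB.
have mAB := measurableU _ _ mA mB.
have add x : n2 (E (A `|` B) x) = n2 (E A x) + n2 (E B x).
  by apply: EFin_inj; rewrite EFinD; exact: (measureU (spectral_meas x)).
have [bA bB bAB] := And3 (pvm_bop mA) (pvm_bop mB) (pvm_bop mAB).
have [[lA lB] lAB] := (bop_linear bA, bop_linear bB, bop_linear bAB).
pose K x := E (A `|` B) x - (E A x + E B x).
have lK : linear K by apply: bop_linear; apply: bop_sub => //; exact: bop_add.
have sK : selfadj K.
  by move=> x y; rewrite rdotDl rdotDr rdotNl rdotNr rdotDl rdotDr !pvm_selfadj.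
have K0 x : K x = 0.
  apply/n2_eq0/le_anti; rewrite n2_ge0 andbT.
  have := @numerical_radius _ _ K 0 lK (lexx 0) _ _ x.
  rewrite expr0n mulr0 mul0r; apply => y.
    by rewrite rdotDl rdotNl rdotDl !pvm_rdot // add subrr normr0 mul0r.
  have := sK y ('i *: y); rewrite (linZ lK) => h.
  rewrite mul0r normr_le0; apply/eqP.
  by move: h; rewrite (rdotC y) rdot_il; lra.
have AB0 x : rdot (E A x) (E B x) = 0.
  have := add x; rewrite (subr0_eq (K0 x)) n2D; lra.
have BA x : E B (E A x) = 0.
  apply: n2_eq0; have := AB0 (E A x); rewrite pvm_idem // rdotC => h.
  by rewrite -pvm_rdot.
by move=> x y; rewrite -pvm_selfadj // BA rdot0l.
Qed.

Lemma pvm_hdot B x : measurable B -> hdot (E B x) x = (n2 (E B x))%:C.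
Proof.
move=> mB; rewrite hdotE pvm_rdot //; congr (_ +i* _).
have := pvm_selfadj mB x ('i *: x); rewrite (linZ (bop_linear (pvm_bop mB))).
by rewrite [RHS]rdotC rdot_il; lra.
Qed.

(* [T] is uniformly close to the sums of the [c i *: E (B i)] over partitions
   into sets [B i] on which [u + i v] is nearly constant. These are isometric
   when the [c i] are chosen among the values of [u + i v]. *)
Lemma unimodular_isometry (T : V -> V) (u v : R -> R) : bop T ->
  measurable_fun setT u -> measurable_fun setT v ->
  (forall l, u l ^+ 2 + v l ^+ 2 = 1) ->
  (forall x, hdot (T x) x =
    fine (\int[spectral_mu E x]_(l in setT) (u l)%:E)%E +i*
    fine (\int[spectral_mu E x]_(l in setT) (v l)%:E)%E) ->
  forall x, n2 (T x) = n2 x.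
Proof.
move=> bT mu mv uv1 hT.
have ET : E setT = id by case: hE.
have u1 l : -1 <= u l <= 1.
  by rewrite -ler_norml -(@ler_pXn2r _ 2) ?nnegrE // expr1n real_normK ?num_real // -(uv1 l) lerDl sqr_ge0.
have v1 l : -1 <= v l <= 1.
  by rewrite -ler_norml -(@ler_pXn2r _ 2) ?nnegrE // expr1n real_normK ?num_real // -(uv1 l) lerDr sqr_ge0.
(* It is enough to approximate [T x] by vectors with exactly the norm of [x]; dividing the tolerance
   by [2 * nrm x + 1] also covers [x = 0]. *)
suff close eps x : 0 < eps -> exists y, n2 y = n2 x /\ nrm (T x - y) <= 2 * eps * nrm x.
  move=> x; rewrite -!nrm_sqr; congr (_ ^+ 2).
  have s0 : 0 < 2 * nrm x + 1 by rewrite ltr_wpDl // mulr_ge0 // nrm_ge0.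
  apply/le_anti/andP; split; apply/ler_addgt0Pr => e e0.
    have [|y [yx hy]] := close (e / (2 * nrm x + 1)) x; first by rewrite divr_gt0.
    rewrite -(subrK y (T x)) (le_trans (nrmD _ _)) // {2}/nrm yx -/(nrm x) addrC lerD2l.
    apply: le_trans hy _; rewrite mulrAC mulrC -mulrA ler_piMr ?(ltW e0) //.
    by rewrite ler_pdivrMl // mulr1; lra.
  have [|y [yx hy]] := close (e / (2 * nrm x + 1)) x; first by rewrite divr_gt0.
  rewrite {1}/nrm -yx -/(nrm y) -[y](subKr (T x)) (le_trans (nrmD _ _)) // lerD2l.
  rewrite {1}/nrm n2N -/(nrm _).
  apply: le_trans hy _; rewrite mulrAC mulrC -mulrA ler_piMr ?(ltW e0) //.
  by rewrite ler_pdivrMl // mulr1; lra.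
move=> e0; have [I [idx [mB near]]] := finite_grid e0 mu mv u1 v1.
pose B i := idx @^-1` [set i].
(* A sample point of each fibre. On an empty fibre it is the default [0], where the coefficient
   still has modulus one. *)
pose p i := xget 0 (B i).
have idxp l : idx (p (idx l)) = idx l by apply: (xgetPex 0 (P := B (idx l))); exists l.
have mBi i : measurable (B i) := mB i.
pose c i := u (p i) +i* v (p i).
pose T' x := \sum_i c i *: E (B i) x.
have fin y : (spectral_meas y setT < +oo)%E by rewrite ltry.
have bnd (w : R -> R) : (forall l, -1 <= w l <= 1) -> exists M : R, forall l, `|w l| <= M.
  by move=> w1; exists 1 => l; rewrite ler_norml.
have meas_sum y : \sum_i n2 (E (B i) y) = n2 y.
  have := @step_integral _ _ _ (spectral_meas y) I idx (fin y) mB (cst 1) (cst 1) 0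
     (measurable_cst _) (ex_intro _ 1 (fun=> _)) (fun=> _).
  rewrite mul0r normr_le0 subr_eq0 Rintegral_cst // mul1r => h.
  have /eqP : fine (spectral_meas y setT) = \sum_i cst 1 i * fine (spectral_meas y (B i)).
    by apply/eqP/h => [|l]; rewrite /= ?normr1 ?subrr ?normr0.
  rewrite /= ET => /eqP ->; by apply: eq_bigr => i _; rewrite mul1r.
exists (T' x); split.
  rewrite n2_sum_orth => [|i j ij].
    rewrite -[RHS]meas_sum; apply: eq_bigr => i _.
    by rewrite n2Z /= uv1 mul1r.
  rewrite rdotZcl; have orth := pvm_disjoint (mBi i) (mBi j).
  have disj : B i `&` B j = set0.
    apply/seteqP; split=> // l [/= li lj]; by move: ij; rewrite -li -lj eqxx.
  rewrite -(linZ (bop_linear (pvm_bop (mBi j)))) orth // mulr0 sub0r.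
  by rewrite -(linZ (bop_linear (pvm_bop (mBi j)))) orth // mulr0 oppr0.
have hT' y : hdot (T' y) y =
    (\sum_i u (p i) * n2 (E (B i) y)) +i* (\sum_i v (p i) * n2 (E (B i) y)).
  rewrite hdot_suml; apply/eqP; rewrite eq_complex !raddf_sum /=.
  apply/andP; split; apply/eqP; apply: eq_bigr => i _;
    by rewrite hdotZl pvm_hdot //=; ring.
have lT' : linear T'.
  move=> a y z; rewrite /T' scaler_sumr -big_split; apply: eq_bigr => i _ /=.
  rewrite (linD (bop_linear (pvm_bop (mBi i)))) (linZ (bop_linear (pvm_bop (mBi i)))).
  by rewrite scalerDr !scalerA [c i * a]mulrC.
have lT := bop_linear bT.
pose K y := T y - T' y.
have lK : linear K.
  by move=> a y z; rewrite /K lT lT' opprD addrACA scalerBr.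
have est (w : R -> R) y : measurable_fun setT w -> (forall l, -1 <= w l <= 1) ->
    (forall l l', idx l = idx l' -> `|w l - w l'| <= eps) ->
    `|fine (\int[spectral_mu E y]_(l in setT) (w l)%:E)%E -
      \sum_i w (p i) * n2 (E (B i) y)| <= eps * n2 y.
  move=> mw w1 hw; rewrite spectral_integral.
  have := @step_integral _ _ _ (spectral_meas y) I idx (fin y) mB w (w \o p) eps mw (bnd w w1).
  rewrite /= ET; apply => l; by apply: hw; rewrite idxp.
rewrite -/(K x) nrm_le ?mulr_ge0 ?(ltW e0) //.
have -> : (2 * eps) ^+ 2 = 4 * eps ^+ 2 by ring.
(* The real and imaginary parts of the form of [T - T'] are each within [eps * n2 y], by comparing
   integrals with sums over the fibres. *)
apply: numerical_radius => // [|y|y]; first exact: ltW.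
  have -> : rdot (K y) y = complex.Re (hdot (T y) y) - complex.Re (hdot (T' y) y).
    by rewrite /rdot hdotBl raddfB.
  rewrite hT hT' /=; apply: est => // l l' ll'; exact: (near l l' ll').1.
have -> : rdot (K y) ('i *: y) = complex.Im (hdot (T y) y) - complex.Im (hdot (T' y) y).
  by rewrite -Im_hdot hdotBl raddfB.
rewrite hT hT' /=; apply: est => // l l' ll'; exact: (near l l' ll').2.
Qed.

End SpectralMeasure.

Lemma propagator_isometry (R : realType) (V : hilbertType R) (hbar : R)
    (D : set V) (A : V -> V) (U : R -> V -> V) t :
  is_propagator hbar D A U -> bop (U t) /\ forall x, n2 (U t x) = n2 x.
Proof.
move=> /(_ t)[/bounded_opP bU [E [hE _ _] hU]]; split => //.
pose g l : R := - (l * t / hbar).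
have cg : continuous g.
  move=> l; apply: cvgN; apply: cvgMl; apply: cvgMl; exact: cvg_id.
apply: (@unimodular_isometry _ _ E hE (U t) (cos \o g) (sin \o g)) => //.
- apply: measurable_realfun.continuous_measurable_fun => l.
  by apply: continuous_comp; [exact: cg|exact: continuous_cos].
- apply: measurable_realfun.continuous_measurable_fun => l.
  by apply: continuous_comp; [exact: cg|exact: continuous_sin].
- by move=> l; exact: cos2Dsin2.
Qed.


(** * Distinguishability of marginals *)

Section Distinguishability.
Context {R : realType}.
Local Open Scope complex_scope.
Local Open Scope ereal_scope.

Lemma selfadj_sub (V : hilbertType R) (A B : V -> V) :
  selfadj A -> selfadj B -> selfadj (A \- B)%R.
Proof. by move=> sA sB x y /=; rewrite rdotDl rdotDr rdotNl rdotNr sA sB. Qed.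

Lemma trnorm_opp_le (V : hilbertType R) (A : V -> V) : bop A -> selfadj A ->
  trnorm (\- A)%R <= trnorm A.
Proof.
move=> bA sA; have [X [Y [pX pY AXY ->]]] := trnorm_decomp bA sA.
rewrite addeC; apply: trnorm_le => //; first exact: bop_opp.
  by move=> x y /=; rewrite rdotNl rdotNr sA.
by move=> x /=; rewrite AXY opprB.
Qed.

Lemma trnorm_triangle (V : hilbertType R) (A B C : V -> V) :
  bop A -> selfadj A -> bop B -> selfadj B ->
  (forall x, C x = (A x + B x)%R) -> trnorm C <= trnorm A + trnorm B.
Proof.
move=> bA sA bB sB CAB; rewrite (_ : C = A \+ B)%R; last exact/funext.
exact: trnormD.
Qed.

Definition is_ptrace (V W Z : hilbertType R) (T : V -> W -> Z)
    (rho : Z -> Z) (A : V -> V) := forall x x',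
  has_sum (hbasis W) (fun e => hdot (rho (T x e)) (T x' e)) (hdot (A x) x').

Lemma hdot_inj (V : hilbertType R) (x y : V) :
  (forall z, hdot x z = hdot y z) -> x = y.
Proof. by move=> h; apply: rdot_inj => z; rewrite /rdot h. Qed.

Lemma ptrace_uniq (V W Z : hilbertType R) (T : V -> W -> Z) rho A :
  pos A -> is_ptrace T rho A ->
  xget (fun=> 0%R) [set A | bounded_op A /\ is_ptrace T rho A] = A.
Proof.
move=> pA hA; apply: xget_unique.
  by split => //; apply/bounded_opP; exact: pos_bop.
move=> B [_ hB]; apply/funext => x; apply: hdot_inj => x'.
exact: has_sum_uniq (hB x x') (hA x x').
Qed.

(** The two parts of an optimal decomposition of [rho1 \- rho2] have finite trace, so both have
    partial traces, with unchanged traces. Uniqueness of unconditional sums identifies the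
    difference of these with [A1 \- A2]. *)
Lemma trnorm_ptrace (V W Z : hilbertType R) (T : V -> W -> Z) rho1 rho2 A1 A2 :
  is_tensor T -> pos rho1 -> pos rho2 -> trnorm (rho1 \- rho2)%R < +oo ->
  pos A1 -> pos A2 -> is_ptrace T rho1 A1 -> is_ptrace T rho2 A2 ->
  trnorm (A1 \- A2)%R <= trnorm (rho1 \- rho2)%R.
Proof.
move=> tT p1 p2 fin pA1 pA2 h1 h2.
have [b1 s1] := (pos_bop p1, pos_selfadj p1).
have [b2 s2] := (pos_bop p2, pos_selfadj p2).
have [X [Y [pX pY XY trE]]] := trnorm_decomp (bop_sub b1 b2) (selfadj_sub s1 s2).
have [X0 Y0] := (trace_ge0 pX, trace_ge0 pY).
have Xfin : trace X < +oo by apply: le_lt_trans fin; rewrite trE leeDl.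
have Yfin : trace Y < +oo by apply: le_lt_trans fin; rewrite trE leeDr.
have [AX pAX [trX hX]] := partial_trace_exists tT pX Xfin.
have [AY pAY [trY hY]] := partial_trace_exists tT pY Yfin.
rewrite trE -trX -trY; apply: trnorm_le => //.
- by apply: bop_sub; exact: pos_bop.
- by apply: selfadj_sub; exact: pos_selfadj.
move=> x /=; apply: hdot_inj => x'; rewrite !hdotBl.
apply: has_sum_uniq (has_sum_lin (h1 x x') (h2 x x')) _.
rewrite (_ : (fun e => _) =
  (fun e => hdot (X (T x e)) (T x' e) - hdot (Y (T x e)) (T x' e))%R).
  exact: has_sum_lin.
by apply/funext => e; rewrite -!hdotBl -XY.
Qed.

Lemma trnorm_tensor (V W Z : hilbertType R) (T : V -> W -> Z)
    (a1 a2 : V -> V) (b1 b2 : W -> W) (K1 K2 : Z -> Z) : is_tensor T ->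
  pos a1 -> pos a2 -> pos b1 -> pos b2 -> pos K1 -> pos K2 ->
  trace a2 = 1 -> trace b1 = 1 ->
  (forall x y, K1 (T x y) = T (a1 x) (b1 y)) ->
  (forall x y, K2 (T x y) = T (a2 x) (b2 y)) ->
  trnorm (K1 \- K2)%R <= trnorm (a1 \- a2)%R + trnorm (b1 \- b2)%R.
Proof.
move=> tT pa1 pa2 pb1 pb2 pK1 pK2 ta tb hK1 hK2.
have [X [Y [pX pY XY ->]]] := trnorm_decomp
  (bop_sub (pos_bop pa1) (pos_bop pa2))
  (selfadj_sub (pos_selfadj pa1) (pos_selfadj pa2)).
have [X' [Y' [pX' pY' XY' ->]]] := trnorm_decomp
  (bop_sub (pos_bop pb1) (pos_bop pb2))
  (selfadj_sub (pos_selfadj pb1) (pos_selfadj pb2)).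
have tT' := tensor_swap tT.
have [KX pKX hKX] := tensor_pos tT pX pb1.
have [KY pKY hKY] := tensor_pos tT pY pb1.
have [KX' pKX' hKX'] := tensor_pos tT pa2 pX'.
have [KY' pKY' hKY'] := tensor_pos tT pa2 pY'.
have tX := trace_tensor_le tT pX pb1 pKX hKX tb.
have tY := trace_tensor_le tT pY pb1 pKY hKY tb.
have tX' := trace_tensor_le tT' pX' pa2 pKX' (fun y x => hKX' x y) ta.
have tY' := trace_tensor_le tT' pY' pa2 pKY' (fun y x => hKY' x y) ta.
apply: (@le_trans _ _ (trace (KX \+ KX')%R + trace (KY \+ KY')%R)); last first.
  by rewrite !trace_add // addeACA; apply: leeD; exact: leeD.
have bK1K2 := bop_sub (pos_bop pK1) (pos_bop pK2).
have pKXX := pos_add pKX pKX'; have pKYY := pos_add pKY pKY'.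
apply: trnorm_le => //; first exact: selfadj_sub (pos_selfadj pK1) (pos_selfadj pK2).
(* The identity is checked on elementary tensors, where the inserted term [a2 (x) b1] cancels. *)
have /funeqP : (K1 \- K2)%R = ((KX \+ KX') \- (KY \+ KY'))%R; last by [].
apply: (bop_tensor_ext tT bK1K2 (bop_sub (pos_bop pKXX) (pos_bop pKYY))) => x y /=.
rewrite hK1 hK2 hKX hKX' hKY hKY' opprD addrACA.
have lr := tens_linr tT; have ll := tens_linl tT.
rewrite -(linB (ll (b1 y))) -XY -(linB (lr (a2 x))) -XY' /=.
by rewrite (linB (ll (b1 y))) (linB (lr (a2 x))) addrA subrK.
Qed.

(** Producing real values for all five norms leaves only real arithmetic for the end; the pair of
    states is arbitrary so that both times are covered. *)
Lemma marginal_bounds (V W Z : hilbertType R) (T : {bilinear V -> W -> Z})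
    (rho1 rho2 : Z -> Z) : hilbert_tensor T -> pos rho1 -> pos rho2 ->
  trace rho1 = 1 -> trace rho2 = 1 ->
  let prod rho := tensor_op T (ptraceE T rho) (ptraceS T rho) in
  exists n s e p x : R,
    [/\ trnorm (rho1 \- rho2)%R = n%:E,
        trnorm (ptraceE T rho1 \- ptraceE T rho2)%R = s%:E,
        trnorm (ptraceS T rho1 \- ptraceS T rho2)%R = e%:E,
        trnorm (prod rho1 \- prod rho2)%R = p%:E &
        trnorm (correlation T rho1 \- correlation T rho2)%R = x%:E] /\
    [/\ s <= n, e <= n, p <= s + e, n <= p + x & p <= n + x]%R.
Proof.
move=> htens p1 p2 t1 t2 prod.
have tT := hilbert_tensorP htens; have tT' := tensor_swap tT.
have marg rho : pos rho -> trace rho = 1 ->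
  [/\ pos (ptraceE T rho), trace (ptraceE T rho) = 1 & is_ptrace T rho (ptraceE T rho)] /\
  [/\ pos (ptraceS T rho), trace (ptraceS T rho) = 1 &
    is_ptrace (fun y x => T x y) rho (ptraceS T rho)].
  move=> pr tr; have fin : trace rho < +oo by rewrite tr ltry.
  have [A pA [tA hA]] := partial_trace_exists tT pr fin.
  have [B pB [tB hB]] := partial_trace_exists tT' pr fin.
  have -> : ptraceE T rho = A by exact: (@ptrace_uniq V W Z T).
  have -> : ptraceS T rho = B by exact: (@ptrace_uniq W V Z (fun y x => T x y)).
  by rewrite tA tB.
have prodP rho : pos rho -> trace rho = 1 -> pos (prod rho) /\
    forall x y, prod rho (T x y) = T (ptraceE T rho x) (ptraceS T rho y).
  move=> pr /(marg _ pr)[[pE _ _] [pS _ _]].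
  have [K pK hK] := tensor_pos tT pE pS.
  suff -> : prod rho = K by [].
  apply: xget_unique; first by split=> //; apply/bounded_opP; exact: pos_bop.
  move=> K' [/bounded_opP bK' hK']; apply: (bop_tensor_ext tT) => // [|x y].
    exact: pos_bop.
  by rewrite hK hK'.
have [[pE1 tE1 hE1] [pS1 tS1 hS1]] := marg _ p1 t1.
have [[pE2 tE2 hE2] [pS2 tS2 hS2]] := marg _ p2 t2.
have [pP1 hP1] := prodP _ p1 t1; have [pP2 hP2] := prodP _ p2 t2.
have bB (U : hilbertType R) (A B : U -> U) : pos A -> pos B -> bop (A \- B)%R.
  by move=> pA pB; apply: bop_sub; exact: pos_bop.
have sB (U : hilbertType R) (A B : U -> U) : pos A -> pos B -> selfadj (A \- B)%R.
  by move=> pA pB; apply: selfadj_sub; exact: pos_selfadj.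
set X := (correlation T rho1 \- correlation T rho2)%R.
have XE x : X x = ((rho1 \- rho2) x - (prod rho1 \- prod rho2) x)%R.
  by rewrite /X /correlation /= !opprB addrACA [RHS]addrACA; congr (_ + _)%R; rewrite addrC.
have bN := bB _ _ _ p1 p2; have sN := sB _ _ _ p1 p2.
have bP := bB _ _ _ pP1 pP2; have sP := sB _ _ _ pP1 pP2.
have XE' : X = ((rho1 \- rho2) \- (prod rho1 \- prod rho2))%R by exact/funext.
have bX : bop X by rewrite XE'; exact: bop_sub.
have sX : selfadj X by rewrite XE'; exact: selfadj_sub.
have nfin : trnorm (rho1 \- rho2)%R < +oo.
  by apply: le_lt_trans (trnorm_le bN sN p1 p2 _) _; rewrite // t1 t2 ltry.
have hs := trnorm_ptrace tT p1 p2 nfin pE1 pE2 hE1 hE2.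
have he := trnorm_ptrace tT' p1 p2 nfin pS1 pS2 hS1 hS2.
have hp := trnorm_tensor tT pE1 pE2 pS1 pS2 pP1 pP2 tE2 tS1 hP1 hP2.
have hn : trnorm (rho1 \- rho2)%R <= trnorm (prod rho1 \- prod rho2)%R + trnorm X.
  by apply: trnorm_triangle => // x; rewrite XE [RHS]addrC subrK.
have hpx : trnorm (prod rho1 \- prod rho2)%R <= trnorm (rho1 \- rho2)%R + trnorm X.
  apply: (@le_trans _ _ (trnorm (rho1 \- rho2)%R + trnorm (\- X)%R)).
    apply: trnorm_triangle => // [|x y|x].
    - exact: bop_opp.
    - by rewrite /= rdotNl rdotNr sX.
    - by rewrite /= XE opprB [RHS]addrC subrK.
  by rewrite leeD2l // trnorm_opp_le.
(* This bound makes the trace norm of the correlation difference finite. *)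
have hx : trnorm X <= trnorm (rho1 \- rho2)%R + trnorm (prod rho1 \- prod rho2)%R.
  apply: (@le_trans _ _ (trnorm (rho1 \- rho2)%R + trnorm (\- (prod rho1 \- prod rho2))%R)).
    apply: trnorm_triangle => // [|x y].
    - exact: bop_opp.
    - by rewrite /= rdotNl rdotNr sP.
  by rewrite leeD2l // trnorm_opp_le.
have n0 := trnorm_ge0 bN sN; have x0 := trnorm_ge0 bX sX.
have p0 := trnorm_ge0 bP sP.
have s0 := trnorm_ge0 (bB _ _ _ pE1 pE2) (sB _ _ _ pE1 pE2).
have e0 := trnorm_ge0 (bB _ _ _ pS1 pS2) (sB _ _ _ pS1 pS2).
have toR (a b : \bar R) : 0 <= a -> a <= b -> b < +oo -> exists r, a = r%:E.
  move=> a0 ab boo; exists (fine a); rewrite fineK // ge0_fin_numE //.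
  exact: le_lt_trans ab boo.
have [n nE] := toR _ _ n0 (lexx _) nfin.
have [s sE] := toR _ _ s0 hs nfin.
have [e eE] := toR _ _ e0 he nfin.
have pfin : trnorm (ptraceE T rho1 \- ptraceE T rho2)%R +
    trnorm (ptraceS T rho1 \- ptraceS T rho2)%R < +oo by rewrite sE eE ltry.
have [p pE] := toR _ _ p0 hp pfin.
have xfin : trnorm (rho1 \- rho2)%R + trnorm (prod rho1 \- prod rho2)%R < +oo.
  by rewrite nE pE ltry.
have [x xE] := toR _ _ x0 hx xfin.
exists n, s, e, p, x; split=> //.
by move: hs he hp hn hpx; rewrite nE sE eE pE xE -!EFinD !lee_fin.
Qed.

Lemma evolve_density (V : hilbertType R) (hbar : R) (D : set V) (H : V -> V)
    (U : R -> V -> V) (rho : V -> V) (t : R) :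
  is_propagator hbar D H U -> density_op rho ->
  pos (evolve U rho t) /\ trace (evolve U rho t) = 1.
Proof.
move=> hU [/pos_opP pr tr]; have [bU nU] := propagator_isometry t hU.
have [U' bU' UU'] := adjoint_exists bU.
rewrite /evolve (adjointE bU' UU'); split; last first.
  by rewrite (trace_isometry pr bU bU' UU' nU).
apply: (pos_conj pr bU' bU) => x y.
by rewrite rdotC -UU' rdotC.
Qed.

Lemma evolve_trnorm (V : hilbertType R) (hbar : R) (D : set V) (H : V -> V)
    (U : R -> V -> V) (rho1 rho2 : V -> V) (t : R) :
  is_propagator hbar D H U -> density_op rho1 -> density_op rho2 ->
  trnorm (evolve U rho1 t \- evolve U rho2 t)%R = trnorm (rho1 \- rho2)%R.
Proof.
move=> hU [/pos_opP p1 _] [/pos_opP p2 _].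
have [bU nU] := propagator_isometry t hU.
have [U' bU' UU'] := adjoint_exists bU.
rewrite -(trnorm_isometry (bop_sub (pos_bop p1) (pos_bop p2))
  (selfadj_sub (pos_selfadj p1) (pos_selfadj p2)) bU bU' UU' nU).
congr trnorm; apply/funext => x.
by rewrite /evolve (adjointE bU' UU') /= (linB (bop_linear bU)).
Qed.

End Distinguishability.

Theorem theorem3 (R : realType) (HS HE HSE : hilbertType R)
    (tens : {bilinear HS -> HE -> HSE}) (htens : hilbert_tensor tens)
    (D : set HSE) (H : HSE -> HSE) (hH : selfadjoint_op D H)
    (hbar : R) (hbar_gt0 : 0 < hbar)
    (U : R -> HSE -> HSE) (hU : is_propagator hbar D H U)
    (rho1 rho2 : HSE -> HSE)
    (hrho1 : density_op rho1) (hrho2 : density_op rho2)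
    (t : R) (t_ge0 : 0 <= t) :
  let rho1SE := evolve U rho1 in
  let rho2SE := evolve U rho2 in
  let rho1S s := ptraceE tens (rho1SE s) in
  let rho2S s := ptraceE tens (rho2SE s) in
  let rho1E s := ptraceS tens (rho1SE s) in
  let rho2E s := ptraceS tens (rho2SE s) in
  let DS s := trdist (rho1S s) (rho2S s) in
  let DE s := trdist (rho1E s) (rho2E s) in
  let Xi s := correlation tens (rho1SE s) \- correlation tens (rho2SE s) in
  let Dprod0 := trdist (tensor_op tens (rho1S 0) (rho1E 0))
                       (tensor_op tens (rho2S 0) (rho2E 0)) in
  let delta0 := (DS 0%R + DE 0%R - Dprod0)%E in
  let DeltaDS := (DS t - DS 0%R)%E in
  let DeltaDE := (DE t - DE 0%R)%E in
  (- delta0 - (2^-1)%:E * trnorm (Xi t) - (2^-1)%:E * trnorm (Xi 0%R)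
     <= DeltaDS + DeltaDE)%E /\
  (DeltaDS + DeltaDE <= DS 0%R + DE 0%R + trnorm (Xi 0%R))%E.
Proof.
move=> rho1SE rho2SE rho1S rho2S rho1E rho2E DS DE Xi Dprod0 delta0 dS dE.
have bounds s := marginal_bounds htens (evolve_density s hU hrho1).1
  (evolve_density s hU hrho2).1 (evolve_density s hU hrho1).2
  (evolve_density s hU hrho2).2.
have [n [s [e [p [x [[nE sE eE pE xE] [h1 h2 h3 h4 h5]]]]]]] := bounds 0.
have [n' [s' [e' [p' [x' [[nE' sE' eE' pE' xE'] [k1 k2 k3 k4 k5]]]]]]] := bounds t.
(* The link between the two times: both values are the trace norm of [rho1 \- rho2]. *)
have nn : n = n'.
  by apply: EFin_inj; rewrite -nE -nE' !(evolve_trnorm _ hU hrho1 hrho2).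
have DS0 : DS 0 = (2^-1 * s)%:E by rewrite /DS /trdist [trnorm _]sE.
have DE0 : DE 0 = (2^-1 * e)%:E by rewrite /DE /trdist [trnorm _]eE.
have DSt : DS t = (2^-1 * s')%:E by rewrite /DS /trdist [trnorm _]sE'.
have DEt : DE t = (2^-1 * e')%:E by rewrite /DE /trdist [trnorm _]eE'.
have Dp : Dprod0 = (2^-1 * p)%:E by rewrite /Dprod0 /trdist [trnorm _]pE.
have X0 : trnorm (Xi 0) = x%:E := xE.
have Xt : trnorm (Xi t) = x'%:E := xE'.
rewrite /delta0 /dS /dE DS0 DE0 DSt DEt Dp X0 Xt.
(* Lower bound: [p <= n + x <= p' + x' + x <= s' + e' + x' + x]. Upper bound: [s'] and [e'] are both
   at most [n <= p + x <= s + e + x]. *)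
rewrite -!(EFinM, EFinN, EFinD, EFinB) !lee_fin; split; lra.
Qed.
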